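(* Let $X_0,X_1$ be Banach spaces with $X_1\subset X_0$ continuously, such that the couple $(X_0,X_1)$ is linearisable with linearisation operators $\Lambda=(\Lambda(t))_{0<t\le1}$. Let $\theta_0\in\,]0,1[$ and let $\widetilde{X}_1$ be a closed subspace of $X_1$ with interpolation order $\theta_0$, associated to a Banach space $Y$. Then for $0<\theta<1$, $1\le p\le\infty$, $$[X_0,\widetilde{X}_1]_{\theta,p}=\Big\{u\in [X_0,X_1]_{\theta,p}:\ \|u\|_{[X_0,X_1]_{\theta,p}}+\big\|\,\|\Lambda(t)u\|_Y\,t^{\theta_0-\theta}\big\|_{L^p([0,1],dt/t)}<\infty\Big\},$$ and the norm of $[X_0,\widetilde{X}_1]_{\theta,p}$ is equivalent to $u\mapsto \|u\|_{[X_0,X_1]_{\theta,p}}+\big\|\,\|\Lambda(t)u\|_Y\,t^{\theta_0-\theta}\big\|_{L^p([0,1],dt/t)}$. Moreover, for $\theta>\theta_0$ the projection $\Pi: X_1\to X_1/\widetilde{X}_1\hookrightarrow Y$ extends to a continuous map $[X_0,X_1]_{\theta,p}\to Y$ (still denoted $\Pi$), and, except for the critical case $\theta=\theta_0$, the interpolation spaces are the following closed subspaces of $[X_0,X_1]_{\theta,p}$: $$[X_0,\widetilde{X}_1]_{\theta,p}=\begin{cases}[X_0,X_1]_{\theta,p}, & \theta<\theta_0,\\ [X_0,X_1]_{\theta,p}\cap\mathrm{Ker}(\Pi), & \theta>\theta_0,\end{cases}$$ where $\mathrm{Ker}(\Pi)$ denotes the kernel of the extension of $\Pi$.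
   Context: $A\sim B$ means $C_1A\le B\le C_2A$ with positive constants independent of all parameters; $A\lesssim B$ means $A\le CB$ similarly. $\widetilde{X}_1$ carries the norm of $X_1$. Real interpolation: with $K(t,u)=\inf\{\|u_0\|_{X_0}+t\|u_1\|_{X_1}: u=u_0+u_1,\ u_0\in X_0,\ u_1\in X_1\}$, the space $[X_0,X_1]_{\theta,p}$ is the set of $u\in X_0$ with $\|t^{-\theta}K(t,u)\|_{L^p(]0,\infty[,dt/t)}<\infty$, with this norm; $[X_0,\widetilde{X}_1]_{\theta,p}$ is defined likewise with $\widetilde{X}_1$ in place of $X_1$. Linearisable couple: $(X_0,X_1)$ is linearisable with linearisation operators $(\Lambda(t))_{0<t\le1}$ if the $\Lambda(t):X_0\to X_1$ are linear maps such that $K(t,u)\sim\|u-\Lambda(t)u\|_{X_0}+t\|\Lambda(t)u\|_{X_1}$ for all $0<t\le1$, $u\in X_0$; equivalently, $\|u-\Lambda(t)u\|_{X_0}+t\|\Lambda(t)u\|_{X_1}\lesssim\min(\|u\|_{X_0},t\|u\|_{X_1})$ (with the convention $\|u\|_{X_1}=\infty$ if $u\notin X_1$). Quotient $J$ norm: for $u\in X_1$, $t>0$, $J(t,u)=\|u\|_{X_0}+t\|u\|_{X_1}$ and $N_J(t,u)=\inf_{v\in\widetilde{X}_1}J(t,u-v)$. Interpolation order: a closed subspace $\widetilde{X}_1\subset X_1$ has interpolation order $\theta_0$, associated to $Y$, if $X_1/\widetilde{X}_1$ is embedded in a Banach space $(Y,\|\cdot\|_Y)$ (meaning that there is a linear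 injective mapping $X_1/\widetilde{X}_1\to Y$, not necessarily an inclusion; for $w\in X_1$ one writes $\|w\|_Y$ for the $Y$-norm of the image of the class of $w$), such that for any $0<s,t\le1$ with $t\sim s$ and any $u,v\in X_0$, $$N_J(t,\Lambda(t)u+\Lambda(s)v)\sim t^{\theta_0}\|\Lambda(t)u+\Lambda(s)v\|_Y .$$ Here $t\sim s$ means $C^{-1}s\le t\le Cs$ for a constant $C\geq 1$, the constants in the equivalence being allowed to depend on $C$ but not on $s,t,u,v$.
   Formalization: For θ>θ₀, the claim that the continuous map on [X₀,X₁]_{θ,p} agrees with Π on X₁ is required only at those w in X₁ with Λ(t)w→w in the Y-norm as t→0; without this convergence a continuous extension of Π need not exist. *)

(* Defs.v *)
From HB Require Import structures.
From mathcomp Require Import all_boot all_order all_algebra.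
From mathcomp Require Import generic_quotient ring_quotient complex.
From mathcomp Require Import all_classical all_reals all_analysis.
From mathcomp Require Import measurable_realfun.

Set Implicit Arguments.
Unset Strict Implicit.
Unset Printing Implicit Defensive.

Import Order.TTheory GRing.Theory Num.Theory.
Import numFieldNormedType.Exports.

Local Open Scope classical_set_scope.
Local Open Scope ring_scope.

(* Banach spaces are real or complex.  Norms in a [normedModType K] take their
   values in K, so [rnorm] is the norm brought back to R; on the values of a
   norm, [scalar_re] loses nothing. *)
Variant scalars (R : realType) : numFieldType -> Type :=
| RealScalars : scalars R R
| ComplexScalars : scalars R R[i].

Definition scalar_re (R : realType) (K : numFieldType) (S : scalars R K) :
    K -> R :=
  match S in scalars _ K' return K' -> R with
  | RealScalars => fun x => x
  | ComplexScalars => fun z => complex.Re z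
  end.

Definition rnorm (R : realType) (K : numFieldType) (S : scalars R K)
  (V : normedModType K) (x : V) : R := scalar_re S `|x|.

(* The library quotients Z-modules only; the scalar action is added here. *)
Section quotient_module.
Local Open Scope quotient_scope.
Variables (K : pzRingType) (V : lmodType K) (D : submodClosed V).

Definition submod_pred (x : V) : bool := x \in D.

Fact submod_pred_zmod_closed : zmod_closed submod_pred.
Proof. exact: GRing.submod_closedB (submodClosedP D). Qed.

HB.instance Definition _ := GRing.isZmodClosed.Build V submod_pred
  submod_pred_zmod_closed.

Definition quot_mod : Type := Quotient.quot (GRing.ZmodClosed.clone V submod_pred _).

HB.instance Definition _ := GRing.Zmodule.on quot_mod.
HB.instance Definition _ := EqQuotient.on quot_mod.

Definition quot_scale (a : K) (x : quot_mod) : quot_mod :=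
  \pi_quot_mod (a *: repr x).

Lemma quot_modE (x y : V) :
  (\pi_quot_mod x == \pi_quot_mod y) = (x - y \in D).
Proof. by rewrite -Quotient.idealrBE. Qed.

Lemma quot_modD (x y : V) :
  \pi_quot_mod (x + y) = \pi_quot_mod x + \pi_quot_mod y.
Proof. exact: (@pi_addr _ _ _ _ _ (Quotient.quot (GRing.ZmodClosed.clone V submod_pred _))). Qed.

Lemma quot_modZ (a : K) (x : V) :
  \pi_quot_mod (a *: x) = quot_scale a (\pi_quot_mod x).
Proof.
apply/eqP; rewrite quot_modE -scalerBr rpredZ// -quot_modE.
by rewrite reprK.
Qed.

Fact quot_scaleA a b x : quot_scale a (quot_scale b x) = quot_scale (a * b) x.
Proof. by elim/quotW: x => x; rewrite -(quot_modZ b) -!quot_modZ scalerA. Qed.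

Fact quot_scale1 : left_id 1 quot_scale.
Proof. by elim/quotW=> x; rewrite -!quot_modZ scale1r. Qed.

Fact quot_scaleDr : right_distributive quot_scale +%R.
Proof.
move=> a; elim/quotW=> x; elim/quotW=> y.
by rewrite -quot_modD -!quot_modZ scalerDr quot_modD.
Qed.

Fact quot_scaleDl x : {morph quot_scale^~ x : a b / a + b}.
Proof.
by elim/quotW: x => x a b; rewrite -!quot_modZ scalerDl quot_modD.
Qed.

HB.instance Definition _ := GRing.Zmodule_isLmodule.Build K quot_mod
  quot_scaleA quot_scale1 quot_scaleDr quot_scaleDl.

Definition quot_class (x : V) : quot_mod := \pi_quot_mod x.

Lemma quot_class_is_linear : linear quot_class.
Proof. by move=> a x y; rewrite /quot_class quot_modD quot_modZ. Qed.

HB.instance Definition _ := GRing.isLinear.Build K V quot_mod *:%R quot_class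
  quot_class_is_linear.

Lemma quot_class_eq0 (x : V) : (quot_class x == 0) = (x \in D).
Proof. by rewrite -(raddf0 quot_class) quot_modE subr0. Qed.

End quotient_module.

(* The measure dt/t on ]0, +oo[, as a measure on R. *)
Section dt_over_t.
Variable R : realType.

Definition inv_pos (t : R) : R := if 0 < t then t^-1 else 0.

Lemma inv_pos_ge0 t : 0 <= inv_pos t.
Proof. by rewrite /inv_pos; case: ifPn => // t0; rewrite invr_ge0 ltW. Qed.

Lemma measurable_inv_pos : measurable_fun [set: R] inv_pos.
Proof.
have -> : inv_pos = (fun t : R => if 0 < t then t `^ (-1) else 0).
  by apply/funext => t; rewrite /inv_pos; case: ifPn => // /ltW/powR_inv1 ->.
by apply: measurable_fun_ifT => //=; exact: measurable_fun_ltr.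
Qed.

Definition dt_over_t (A : set R) : \bar R :=
  (\int[@lebesgue_measure R]_(t in A) (inv_pos t)%:E)%E.

Let dt_over_t0 : dt_over_t set0 = 0%E.
Proof. exact: integral_set0. Qed.

Let dt_over_t_ge0 A : (0 <= dt_over_t A)%E.
Proof. by apply: integral_ge0 => t _; rewrite lee_fin inv_pos_ge0. Qed.

Let dt_over_t_sigma_additive : semi_sigma_additive dt_over_t.
Proof.
move=> /= F mF tF mUF; rewrite /dt_over_t; apply: cvg_toP.
  apply: ereal_nondecreasing_is_cvgn => m n mn.
  apply: lee_sum_nneg_natr => // k _ _; exact: dt_over_t_ge0.
rewrite ge0_integral_bigcup//=.
- apply: measurable_funTS; apply: measurableT_comp => //.
  exact: measurable_inv_pos.
- by move=> t _; rewrite lee_fin inv_pos_ge0.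
Qed.

HB.instance Definition _ := isMeasure.Build _ _ _ dt_over_t
  dt_over_t0 dt_over_t_ge0 dt_over_t_sigma_additive.

End dt_over_t.

(* The inclusion of X1 in X0 is the injection i.  A set D of elements of X1
   stands for the space D with the norm of X1: D is X1 itself ([setT]) or the
   subspace tilde X1.  Since Lambda is only used on ]0, 1], the operators
   Lambda(t) for other t are irrelevant. *)
Section couple.
Variables (R : realType) (K : numFieldType) (S : scalars R K).
Variables (X0 X1 : completeNormedModType K) (i : {linear X1 -> X0}).

Definition K_functional (D : set X1) (t : R) (u : X0) : R :=
  inf [set r | exists (u0 : X0) (u1 : X1), [/\ D u1, u = u0 + i u1 &
                               r = rnorm S u0 + t * rnorm S u1]].

Definition interp_norm (D : set X1) (theta : R) (p : \bar R) (u : X0) : \bar R :=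
  'N[dt_over_t (R := R)]_p[(fun t => (t `^ (- theta) * K_functional D t u)%:E)].

Definition interp_space (D : set X1) (theta : R) (p : \bar R) : set X0 :=
  [set u | (interp_norm D theta p u < +oo)%E].

Definition linearisable (Lambda : R -> {linear X0 -> X1}) : Prop :=
  exists C1 C2 : R, [/\ 0 < C1, 0 < C2 &
    forall t u, 0 < t <= 1 ->
      C1 * (rnorm S (u - i (Lambda t u)) + t * rnorm S (Lambda t u))
        <= K_functional setT t u
        <= C2 * (rnorm S (u - i (Lambda t u)) + t * rnorm S (Lambda t u))].

Definition J_functional (t : R) (w : X1) : R := rnorm S (i w) + t * rnorm S w.

Definition quotient_J_norm (D : set X1) (t : R) (w : X1) : R :=
  inf [set J_functional t (w - v) | v in D].

Section interpolation_order.
Variables (Lambda : R -> {linear X0 -> X1}) (D : submodClosed X1).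
Variables (Y : completeNormedModType K) (j : {linear quot_mod D -> Y}).

(* the projection Pi : X1 -> X1 / D -> Y, with |w|_Y = rnorm S (quot_proj w) *)
Definition quot_proj (w : X1) : Y := j (quot_class D w).

Definition interpolation_order (theta0 : R) : Prop :=
  injective j /\
  forall C : R, 1 <= C -> exists c1 c2 : R, [/\ 0 < c1, 0 < c2 &
    forall (s t : R) (u v : X0),
      0 < s <= 1 -> 0 < t <= 1 -> C^-1 * s <= t <= C * s ->
      let w := Lambda t u + Lambda s v in
      c1 * (t `^ theta0 * rnorm S (quot_proj w))
        <= quotient_J_norm [set` D] t w
        <= c2 * (t `^ theta0 * rnorm S (quot_proj w))].

Definition trace_norm (theta0 theta : R) (p : \bar R) (u : X0) : \bar R :=
  'N[dt_over_t (R := R)]_p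
    [(fun t => (rnorm S (quot_proj (Lambda t u)) * t `^ (theta0 - theta))%:E)
       \_ `[0, 1]].

End interpolation_order.

(* In the notions below, E is a linear subspace of X0 normed by N. *)

Definition equivalent_norms (E : set X0) (N M : X0 -> \bar R) : Prop :=
  exists C1 C2 : R, [/\ 0 < C1, 0 < C2 &
    forall u, E u -> (C1%:E * N u <= M u <= C2%:E * N u)%E].

Definition closed_subspace (E : set X0) (N : X0 -> \bar R) (A : set X0) : Prop :=
  [/\ A `<=` E, A 0, (forall (a : K) u v, A u -> A v -> A (a *: u + v)) &
    forall u, E u ->
      (forall e : R, 0 < e -> exists2 v, A v & (N (u - v)%R < e%:E)%E) -> A u].

Definition linear_on (E : set X0) (Y : completeNormedModType K) (f : X0 -> Y) :
    Prop :=
  forall (a : K) u v, E u -> E v -> f (a *: u + v) = a *: f u + f v.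

Definition continuous_on (E : set X0) (N : X0 -> \bar R)
    (Y : completeNormedModType K) (f : X0 -> Y) : Prop :=
  forall u, E u -> forall e : R, 0 < e -> exists2 d : R, 0 < d &
    forall v, E v -> (N (u - v)%R < d%:E)%E -> rnorm S (f u - f v) < e.

End couple.

(* Main.v *)
From HB Require Import structures.
Require Import Defs.
From mathcomp Require Import complex.
From mathcomp Require Import all_boot all_order all_algebra.
From mathcomp Require Import all_classical all_reals all_analysis.
From mathcomp Require Import measurable_realfun ess_sup_inf ring lra.

(** Write K(t,u) and K~(t,u) for the K-functionals of (X0, X1) and of
    (X0, tilde X1), where tilde X1 is the subspace D.

    Splitting u as (u - Lambda(t) u) + (Lambda(t) u - v) + v with v in D, and
    using that Lambda(t) realises K(t,u), gives for 0 < t <= 1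
      K~(t,u) ~ K(t,u) + N_J(t, Lambda(t) u)
              ~ K(t,u) + t^theta0 |Lambda(t) u|_Y
    ([trace_le_KD], [KD_le_trace]).  For t >= 1 both K-functionals are
    comparable to |u|_X0, so taking weighted L^p norms gives the first
    description of the interpolation space.

    The interpolation order says more: if s and t are within a factor 2, then
      t^theta0 |Lambda(t) u - Lambda(s) u|_Y <= C K(t,u)
    ([trace_difference_le]), because the X1 part of the decomposition of u
    changes little between the two scales.  Hence the function
    f(t) = t^(theta0 - theta) |Lambda(t) u|_Y satisfies
      f(t) <= C t^-theta K(t,u) + c^(theta - theta0) f(c t),   c = 2 or 1/2.
    The coefficient q = c^(theta - theta0) is smaller than 1 for c = 2 when
    theta < theta0, and for c = 1/2 when theta > theta0.  Iterating this
    inequality and using that dt/t is invariant under dilations bounds the L^p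
    norm of f by that of t^-theta K(t,u), as in Hardy's inequality
    ([Lnorm_Hardy]), as soon as the remainder q^n f(c^n t) tends to 0.
    - For theta < theta0 the remainder vanishes because f is cut off at 1:
      the second norm is dominated by the first one.
    - For theta > theta0 the remainder is a multiple of
      |Lambda(2^-n t) u|_Y.  The increments of Lambda(t) u in Y are bounded by
      t^(theta - theta0), so Lambda(t) u converges in Y as t tends to 0; the
      limit is Pi u, and the remainder tends to 0 exactly when Pi u = 0.
      Conversely t^theta0 |Lambda(t) u|_Y <= C K~(t,u) = O(t^theta) forces
      Pi u = 0 on the smaller space.

    The function t |-> |Lambda(t) u|_Y may fail to be measurable, in which case
    its L^p norm is built on a lower integral, which is monotone but not
    subadditive.  All estimates are arranged so that this function is only
    compared with measurable ones ([Lnorm_le_add], [Lnorm_Hardy]). *)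

Set Implicit Arguments.
Unset Strict Implicit.
Unset Printing Implicit Defensive.

Import Order.TTheory GRing.Theory Num.Theory.
Import numFieldNormedType.Exports.

Local Open Scope classical_set_scope.
Local Open Scope ring_scope.

(** * L^p norms of nonnegative, possibly nonmeasurable functions *)

Lemma le_poweR (R : realType) (r : R) (x y : \bar R) : (0 <= r)%R ->
  (0 <= x)%E -> (x <= y)%E -> (x `^ r <= y `^ r)%E.
Proof.
move=> r0 x0 xy; apply: gt0_ler_poweR => //; rewrite in_itv/= leey andbT//.
exact: le_trans xy.
Qed.

Section Lp_norms_of_nonnegative_functions.
Context d (T : measurableType d) (R : realType).
Variable mu : {measure set T -> \bar R}.
Local Open Scope ereal_scope.

Import HBNNSimple.

(** The integral of a nonnegative function is the supremum over the simple
    functions below it; truncating these to the complement of N does not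
    change their integrals and puts them below g. *)
Lemma le_integral_off_null (N : set T) (f g : T -> \bar R) :
  measurable N -> mu N = 0 -> (forall x, 0 <= f x) -> (forall x, 0 <= g x) ->
  (forall x, ~ N x -> f x <= g x) -> \int[mu]_x f x <= \int[mu]_x g x.
Proof.
move=> mN N0 f0 g0 fg; rewrite !ge0_integralTE//.
apply: ge_ereal_sup => _ /= [h hf <-].
have mNC : measurable (~` N) by exact: measurableC.
apply: le_ereal_sup_tmp.
exists (sintegral mu (proj_nnsfun h mNC)).
  exists (proj_nnsfun h mNC) => //= x.
  rewrite mindicE; have [/set_mem/= Nx|_] := boolP (x \in ~` N).
    by rewrite mulr1 (le_trans (hf x))// fg.
  by rewrite mulr0.
rewrite -!integralT_nnsfun le_eqVlt; apply/orP; left; apply/eqP.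
apply: ae_eq_integral => //; [exact/measurable_EFinP.. |].
exists N; split=> // x /=; apply: contra_notP => Nx _.
by rewrite mindicE (_ : x \in ~` N) ?mulr1// inE.
Qed.

Lemma le_Lnorm_off_null (N : set T) (p : \bar R) (f g : T -> R) :
  measurable N -> mu N = 0 -> 1 <= p ->
  (forall x, ~ N x -> (0 <= f x <= g x)%R) ->
  'N[mu]_p[EFin \o f] <= 'N[mu]_p[EFin \o g].
Proof.
move=> mN N0 p1 fg; rewrite unlock /Lnorm.
have nfg x : ~ N x -> (`|f x| <= `|g x|)%R.
  move=> /fg /andP[f0 fgx].
  by rewrite !ger0_norm// (le_trans f0).
case: p p1 => [p| |]//.
- rewrite lee_fin => p1.
  have p0 : (0 <= p)%R by rewrite (le_trans _ p1).
  apply: le_poweR; rewrite ?invr_ge0//.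
    by apply: integral_ge0 => x _; exact: poweR_ge0.
  apply: (le_integral_off_null mN N0) => [x|x|x Nx]; try exact: poweR_ge0.
  by rewrite !abse_EFin !poweR_EFin lee_fin ge0_ler_powR// nfg.
- move=> _; case: ifPn => // mu0; apply: le_ess_sup.
  exists N; split=> // x /=; apply: contra_notP => Nx.
  by rewrite lee_fin nfg.
Qed.

Lemma le_Lnorm (p : \bar R) (f g : T -> R) : 1 <= p ->
  (forall x, (0 <= f x <= g x)%R) ->
  'N[mu]_p[EFin \o f] <= 'N[mu]_p[EFin \o g].
Proof. by move=> p1 fg; apply: (@le_Lnorm_off_null set0). Qed.

Lemma LnormZ_ge0 (p : \bar R) (k : R) (f : T -> R) : 1 <= p -> (0 <= k)%R ->
  measurable_fun setT f ->
  'N[mu]_p[EFin \o (fun x => k * f x)%R] = k%:E * 'N[mu]_p[EFin \o f].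
Proof.
move=> p1 k0 mf; rewrite unlock /Lnorm.
case: p p1 => [p| |]//.
- rewrite lee_fin => p1.
  have p0 : (0 < p)%R by rewrite (lt_le_trans _ p1).
  under eq_integral do
    rewrite /= normrM (ger0_norm k0) powRM// EFinM.
  rewrite ge0_integralZl_EFin//; last 2 first.
  + apply/measurable_EFinP.
    apply: (@measurableT_comp _ _ _ _ _ _ (@powR R ^~ p)) => //.
    exact: measurableT_comp.
  + exact: powR_ge0.
  rewrite poweRM ?lee_fin ?powR_ge0//; last first.
    by apply: integral_ge0 => x _; rewrite lee_fin powR_ge0.
  by rewrite poweR_EFin -powRrM divff ?gt_eqF// powRr1.
- move=> _; case: ifPn => mu0; last by rewrite mule0.
  rewrite -ess_supZl//; apply: eq_ess_sup; apply: nearW => x /=.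
  by rewrite normrM ger0_norm.
Qed.

(** Minkowski's inequality where g need not be measurable: (h - f)^+ is a
    measurable function below g, and h <= f + (h - f)^+. *)
Lemma Lnorm_le_add (p : \bar R) (h f g : T -> R) : 1 <= p ->
  measurable_fun setT h -> measurable_fun setT f ->
  (forall x, 0 <= h x)%R -> (forall x, 0 <= f x)%R -> (forall x, 0 <= g x)%R ->
  (forall x, h x <= f x + g x)%R ->
  'N[mu]_p[EFin \o h] <= 'N[mu]_p[EFin \o f] + 'N[mu]_p[EFin \o g].
Proof.
move=> p1 mh mf h0 f0 g0 hfg.
pose k x := Num.max (h x - f x)%R 0%R.
have mk : measurable_fun setT k.
  by apply: measurable_maxr => //; exact: measurable_funB.
apply: (@le_trans _ _ ('N[mu]_p[EFin \o (f \+ k)%R])).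
  apply: le_Lnorm => // x; rewrite h0/= /k -lerBlDl.
  by rewrite le_max lexx.
apply: (le_trans (eminkowski _ mf mk p1)).
rewrite leeD2l// le_Lnorm// => x.
by rewrite /k le_max lexx orbT/= ge_max g0 andbT lerBlDl.
Qed.

(** Monotone convergence for L^p norms, in the form of a bound for any
    function f that lies below the pointwise limit of the G n. *)
Lemma Lnorm_le_nondecreasing_limit (p B : \bar R) (G : nat -> T -> R)
    (f : T -> R) : 1 <= p ->
  (forall n, measurable_fun setT (G n)) -> (forall n x, 0 <= G n x)%R ->
  (forall n x, G n x <= G n.+1 x)%R -> (forall x, 0 <= f x)%R ->
  (forall x b, (forall n, G n x <= b)%R -> (f x <= b)%R) ->
  (forall n, 'N[mu]_p[EFin \o G n] <= B) -> 'N[mu]_p[EFin \o f] <= B.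
Proof.
move=> p1 mG G0 Gnd f0 fG; rewrite unlock /Lnorm.
case: p p1 => [p| |]//.
- rewrite lee_fin => p1.
  have p0 : (0 < p)%R by rewrite (lt_le_trans _ p1).
  move=> GB; pose H n x := (G n x `^ p)%:E.
  have H0 n x : 0 <= H n x by rewrite lee_fin powR_ge0.
  have mH n : measurable_fun setT (H n).
    apply/measurable_EFinP.
    exact: (@measurableT_comp _ _ _ _ _ _ (@powR R ^~ p)).
  have Hnd x : nondecreasing_seq (H ^~ x).
    apply/nondecreasing_seqP => n /=.
    by rewrite lee_fin ge0_ler_powR ?nnegrE ?(ltW p0).
  have Hl x n : H n x <= limn (H ^~ x).
    apply: lime_ge; first exact: ereal_nondecreasing_is_cvgn.
    by exists n => // m /= nm; exact: Hnd.
  have B0 : 0 <= B by rewrite (le_trans _ (GB 0%N))// poweR_ge0.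
  have HB n : \int[mu]_x H n x <= B `^ p.
    have -> : \int[mu]_x H n x =
        ((\int[mu]_x `|(EFin \o G n) x| `^ p) `^ p^-1) `^ p.
      rewrite -poweRrM mulVf ?gt_eqF// poweRe1; last first.
        by apply: integral_ge0 => x _; exact: poweR_ge0.
      by apply: eq_integral => x _; rewrite /H/= ger0_norm.
    by apply: le_poweR; rewrite ?(ltW p0)//; exact: poweR_ge0.
  have limB : \int[mu]_x limn (H ^~ x) <= B `^ p.
    rewrite monotone_convergence//.
    apply: lime_le; last by apply: nearW => n; exact: HB.
    apply: ereal_nondecreasing_is_cvgn; apply/nondecreasing_seqP => n.
    by apply: ge0_le_integral => // x _; exact: Hnd.
  have -> : B = (B `^ p) `^ p^-1.
    by rewrite -poweRrM divff ?gt_eqF// poweRe1.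
  apply: le_poweR; rewrite ?invr_ge0 ?(ltW p0)//.
    by apply: integral_ge0 => x _; exact: poweR_ge0.
  apply: le_trans limB; apply: (@le_integral_off_null set0) => //.
  - by move=> x; exact: poweR_ge0.
  - by move=> x; exact: le_trans (H0 0%N x) (Hl x 0%N).
  move=> x _; rewrite /= ger0_norm//.
  move: (Hl x); case: (limn _) => [l| |] {}Hl; last 2 first.
  - by rewrite leey.
  - by have := Hl 0%N.
  rewrite lee_fin.
  have l0 : (0 <= l)%R by rewrite -lee_fin (le_trans _ (Hl 0%N)).
  have -> : (l = (l `^ p^-1) `^ p)%R.
    by rewrite -powRrM mulVf ?gt_eqF// powRr1.
  apply: ge0_ler_powR; rewrite ?nnegrE ?powR_ge0 ?(ltW p0)//.
  apply: fG => n.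
  have -> : (G n x = (G n x `^ p) `^ p^-1)%R.
    by rewrite -powRrM divff ?gt_eqF// powRr1.
  apply: ge0_ler_powR; rewrite ?nnegrE ?invr_ge0 ?powR_ge0 ?(ltW p0)//.
  by have := Hl n; rewrite lee_fin.
- move=> _ GB; case: ifPn GB => mu0 GB; last exact: (GB 0%N).
  apply/ess_supP.
  have : \forall x \ae mu, forall n, `|(G n x)%:E| <= B.
    by apply/ae_foralln => n; apply/ess_supP; exact: GB.
  apply: filterS => x /= GBx.
  move: GBx; case: B GB => [b| |] _ GBx; [|by rewrite leey|by have := GBx 0%N].
  rewrite lee_fin ger0_norm//; apply: fG => n.
  by have := GBx n; rewrite lee_fin ger0_norm.
Qed.

End Lp_norms_of_nonnegative_functions.

(** * A Hardy inequality for measure preserving maps *)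

Section Hardy_inequality.
Context d (T : measurableType d) (R : realType).
Variable mu : {measure set T -> \bar R}.
Variables (phi : T -> T) (mphi : measurable_fun setT phi).
Hypothesis phi_mu : forall A, measurable A -> mu (phi @^-1` A) = mu A.
Local Open Scope ereal_scope.

Lemma Lnorm_comp_le (p : \bar R) (f : T -> R) : 1 <= p ->
  measurable_fun setT f ->
  'N[mu]_p[EFin \o (f \o phi)] <= 'N[mu]_p[EFin \o f].
Proof.
move=> p1 mf; rewrite unlock /Lnorm; case: p p1 => [p| |]//.
- rewrite lee_fin => p1.
  have p0 : (0 < p)%R by rewrite (lt_le_trans _ p1).
  apply: le_poweR; rewrite ?invr_ge0 ?(ltW p0)//.
    by apply: integral_ge0 => x _; exact: poweR_ge0.
  pose F x := `|(f x)%:E| `^ p.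
  have mF : measurable_fun setT F.
    apply/measurable_EFinP.
    apply: (@measurableT_comp _ _ _ _ _ _ (@powR R ^~ p)) => //.
    exact: measurableT_comp.
  pose psi : {mfun T >-> T} :=
    HB.pack phi (isMeasurableFun.Build _ _ _ _ phi mphi).
  have <- : \int[pushforward mu psi]_x F x = \int[mu]_x (F \o phi) x.
    rewrite ge0_integral_pushforward// => x _.
    exact: poweR_ge0.
  rewrite le_eqVlt; apply/orP; left; apply/eqP.
  by apply: eq_measure_integral => A mA _; exact: phi_mu.
- move=> _; case: ifPn => // mu0; apply/ess_supP.
  have [N [mN N0 fN]] := ess_sup_ge mu (abse \o (EFin \o f)).
  exists (phi @^-1` N); split.
  + by rewrite -[X in measurable X]setTI; exact: mphi.
  + by rewrite phi_mu.
  by move=> x /= fx; exact: fN.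
Qed.

(** Iterating the hypothesis n times bounds f by the sum over k < n of
    q^k (F o phi^k), plus a remainder which can be made arbitrarily small.
    Each F o phi^k has L^p norm at most that of F, whence the geometric
    series. *)
Lemma Lnorm_Hardy (p : \bar R) (q : R) (f F : T -> R) : 1 <= p ->
  (0 <= q < 1)%R -> measurable_fun setT F ->
  (forall x, 0 <= F x)%R -> (forall x, 0 <= f x)%R ->
  (forall x, f x <= F x + q * f (phi x))%R ->
  (forall x e, 0 < e -> exists n, q ^+ n * f (iter n phi x) <= e)%R ->
  'N[mu]_p[EFin \o f] <= ((1 - q)^-1)%:E * 'N[mu]_p[EFin \o F].
Proof.
move=> p1 /andP[q0 q1] mF F0 f0 fF fq.
(* G n x is the sum over k < n of q^k F (phi^k x) *)
pose G := fix G n x := if n is m.+1 then (F x + q * G m (phi x))%R else 0%R.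
have G0 n x : (0 <= G n x)%R.
  by elim: n x => //= n IH x; rewrite addr_ge0// mulr_ge0.
have mG n : measurable_fun setT (G n).
  elim: n => [|n IH]/=; first exact: measurable_cst.
  apply: measurable_funD => //; apply: measurable_funM => //.
  exact: (measurableT_comp IH).
have fG n x : (f x <= G n x + q ^+ n * f (iter n phi x))%R.
  elim: n x => [|n IH] x; first by rewrite expr0 mul1r/= add0r.
  rewrite iterSr exprS /= (le_trans (fF x))// -addrA lerD2l -mulrA -mulrDr.
  by rewrite ler_wpM2l.
have q1' : (0 < 1 - q)%R by rewrite subr_gt0.
apply: (@Lnorm_le_nondecreasing_limit _ _ _ _ _ _ G) => //.
- elim=> [|n IH] x /=; first by rewrite addr_ge0 ?mulr_ge0.
  by rewrite lerD2l ler_wpM2l// IH.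
- move=> x b Gb; apply/ler_addgt0Pr => e e0.
  have [n fn] := fq x e e0.
  by rewrite (le_trans (fG n x))// lerD.
elim=> [|n IH].
  rewrite (_ : EFin \o G 0%N = cst 0)// Lnorm0.
    by apply: mule_ge0; [rewrite lee_fin invr_ge0 ltW|exact: Lnorm_ge0].
  by rewrite gt_eqF// (lt_le_trans _ p1).
have mGphi : measurable_fun setT (G n \o phi) by exact: measurableT_comp.
pose H x := (q * (G n \o phi) x)%R.
have mH : measurable_fun setT H by exact: measurable_funM.
apply: le_trans (eminkowski mu mF mH p1) _.
rewrite LnormZ_ge0//.
have qN : q%:E * 'N[mu]_p[EFin \o (G n \o phi)] <=
    q%:E * (((1 - q)^-1)%:E * 'N[mu]_p[EFin \o F]).
  by apply: lee_wpmul2l => //; exact: le_trans (Lnorm_comp_le p1 (mG n)) IH.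
apply: le_trans (leeD2l _ qN) _.
rewrite muleA -EFinM -{1}['N[mu]_p[_]]mul1e -ge0_muleDl; last 2 first.
- by rewrite lee_fin.
- by rewrite lee_fin mulr_ge0// invr_ge0 ltW.
apply: lee_wpmul2r; first exact: Lnorm_ge0.
rewrite lee_fin le_eqVlt; apply/orP; left; apply/eqP.
by field; rewrite gt_eqF.
Qed.

End Hardy_inequality.

(** * The measure dt/t *)

Section the_measure_dt_over_t.
Variable R : realType.
Notation lambda := (@lebesgue_measure R).

Definition dilation (c t : R) : R := c * t.

Lemma measurable_dilation c : measurable_fun setT
  (dilation c : measurableTypeR R -> measurableTypeR R).
Proof. exact: measurable_funM. Qed.

Definition dilated_lebesgue (c : R) : set (measurableTypeR R) -> \bar R :=
  pushforward lambda (dilation c : measurableTypeR R -> measurableTypeR R).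

HB.instance Definition _ c := Measure.copy (dilated_lebesgue c)
  (measure_function_pushforward__canonical__measure_function_Measure
     lambda (measurable_dilation c)).

(** Lebesgue measure is characterised by its values on intervals. *)
Lemma lebesgue_measure_dilation (c : R) (c0 : 0 < c) (A : set R) :
  measurable A ->
  mscale (NngNum (ltW c0))
    (dilated_lebesgue c) A = lambda A.
Proof.
move=> mA; apply/esym/lebesgue_measure_unique => //= _ [[a b]] _ <-.
rewrite /mscale/= /dilated_lebesgue /pushforward.
rewrite (_ : dilation c @^-1` _ = `]c^-1 * a, c^-1 * b]%classic); last first.
  apply/seteqP; split=> t /=; rewrite !in_itv/= /dilation => /andP[at_ tb].
    by rewrite ltr_pdivrMl// ler_pdivlMl// at_.
  by move: at_ tb; rewrite ltr_pdivrMl// ler_pdivlMl// => -> ->.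
rewrite !lebesgue_measure_itv/= !lte_fin ltr_pM2l ?invr_gt0//.
case: ifPn => ab; last by rewrite mule0.
by rewrite -!EFinD -EFinM mulrBr !mulrA divff ?gt_eqF// !mul1r.
Qed.

(** The Jacobian c of the dilation is absorbed by the density 1/t. *)
Lemma dt_over_t_dilation (c : R) (A : set R) : 0 < c -> measurable A ->
  dt_over_t (dilation c @^-1` A) = dt_over_t A.
Proof.
move=> c0 mA; rewrite /dt_over_t.
have mI (B : set R) :
    measurable_fun (B : set (measurableTypeR R)) (fun t => (inv_pos t)%:E).
  by apply: measurable_funTS; apply/measurable_EFinP; exact: measurable_inv_pos.
have I0 t : (0 <= (inv_pos t)%:E)%E by rewrite lee_fin inv_pos_ge0.
pose mu := mscale (NngNum (ltW c0))
    (dilated_lebesgue c).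
have <- : (\int[mu]_(t in A) (inv_pos t)%:E =
           \int[lambda]_(t in A) (inv_pos t)%:E)%E.
  by apply: eq_measure_integral => B mB _; exact: lebesgue_measure_dilation.
rewrite ge0_integral_mscale//.
have -> : (\int[dilated_lebesgue c]_(t in A) (inv_pos t)%:E =
    \int[lambda]_(t in dilation c @^-1` A) (inv_pos (dilation c t))%:E)%E.
  exact: (ge0_integral_pushforward (measurable_dilation c)).
have mcA : measurable (dilation c @^-1` A : set (measurableTypeR R)).
  by rewrite -[X in measurable X]setTI; exact: measurable_dilation.
have mIc : measurable_fun (dilation c @^-1` A : set (measurableTypeR R))
    (fun t => (inv_pos (dilation c t))%:E).
  apply: measurable_funTS.
  by apply: (measurableT_comp (mI setT)); exact: measurable_dilation.
rewrite -ge0_integralZl// ?lee_fin ?ltW//.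
apply: eq_integral => t _; rewrite /= -EFinM /inv_pos /dilation pmulr_rgt0//.
by case: ifPn => t0; rewrite ?mulr0// invfM mulrA divff ?gt_eqF// mul1r.
Qed.

Lemma dt_over_t_nonpositive : dt_over_t [set t : R | ~ 0 < t] = 0%E.
Proof.
apply: integral0_eq => t /= /negP t0.
by rewrite /inv_pos (negbTE t0).
Qed.

Lemma measurable_nonpositive : measurable [set t : R | ~ 0 < t].
Proof.
rewrite (_ : [set t | _] = `]-oo, 0]%classic)//.
by apply/seteqP; split=> t /=; rewrite in_itv/= leNgt => /negP.
Qed.

(** The exact value is ln 2; this bound, uniform in s, is what turns an L^p
    bound into a pointwise one. *)
Lemma dt_over_t_dyadic (s : R) : 0 < s ->
  ((2^-1)%:E <= dt_over_t `[s, (2 * s)%R])%E.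
Proof.
move=> s0; rewrite /dt_over_t.
(* the density is at least 1 / (2 s) on an interval of length s *)
apply: (@le_trans _ _ (\int[lambda]_(t in `[s, (2 * s)%R]) ((2 * s)^-1)%:E)%E).
  rewrite integral_cst//= lebesgue_measure_itv/= lte_fin.
  rewrite ifT; last lra.
  rewrite -EFinD -EFinM lee_fin le_eqVlt; apply/orP; left; apply/eqP.
  by field; rewrite gt_eqF.
apply: ge0_le_integral => //.
- by move=> t _; rewrite lee_fin invr_ge0; lra.
- by apply: measurable_funTS; apply/measurable_EFinP; exact: measurable_inv_pos.
- move=> t /=; rewrite in_itv/= => /andP[st ts].
  have t0 : 0 < t by lra.
  by rewrite lee_fin /inv_pos t0 lef_pV2 ?posrE//; lra.
Qed.

End the_measure_dt_over_t.

(** * L^p norms with respect to dt/t *)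

Section Lp_norms_for_dt_over_t.
Variables (R : realType) (p : \bar R).
Hypothesis p1 : (1 <= p)%E.
Implicit Types f g h : R -> R.

Notation Lp f := ('N[dt_over_t (R := R)]_p[EFin \o f])%E.

(** The measure dt/t is carried by the positive half-line, and the weighted
    K-functional is only well behaved there. *)
Definition on_pos f (t : R) : R := if 0 < t then f t else 0.

Lemma le_Lp f g : (forall t, 0 < t -> 0 <= f t <= g t) -> (Lp f <= Lp g)%E.
Proof.
move=> fg.
apply: (le_Lnorm_off_null (@measurable_nonpositive R)) => //.
  exact: dt_over_t_nonpositive.
by move=> t /= /contrapT; exact: fg.
Qed.

Lemma Lp_on_pos f : (forall t, 0 < t -> 0 <= f t) -> Lp (on_pos f) = Lp f.
Proof.
move=> f0; apply/eqP; rewrite eq_le !le_Lp// => t t0;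
  by rewrite /on_pos t0 f0// lexx.
Qed.

Lemma on_pos_ge0 f : (forall t, 0 < t -> 0 <= f t) -> forall t, 0 <= on_pos f t.
Proof. by move=> f0 t; rewrite /on_pos; case: ifPn => // /f0. Qed.

Lemma Lp_le_scale (C : R) f g : 0 <= C ->
  measurable_fun setT (on_pos g) -> (forall t, 0 < t -> 0 <= g t) ->
  (forall t, 0 < t -> 0 <= f t <= C * g t) -> (Lp f <= C%:E * Lp g)%E.
Proof.
move=> C0 mg g0 fg; rewrite -(Lp_on_pos g0) -LnormZ_ge0//.
by apply: le_Lp => t t0; rewrite /on_pos t0 fg.
Qed.

Lemma Lp_le_add (C : R) f g h : 0 < C ->
  measurable_fun setT (on_pos h) -> measurable_fun setT (on_pos f) ->
  (forall t, 0 < t -> 0 <= h t) -> (forall t, 0 < t -> 0 <= f t) ->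
  (forall t, 0 < t -> 0 <= g t) ->
  (forall t, 0 < t -> h t <= C * (f t + g t)) ->
  (Lp h <= C%:E * (Lp f + Lp g))%E.
Proof.
move=> C0 mh mf h0 f0 g0 hfg.
have -> : Lp h = (C%:E * Lp (fun t => C^-1 * on_pos h t)%R)%E.
  rewrite LnormZ_ge0 ?invr_ge0 ?(ltW C0)//.
  by rewrite muleA -EFinM divff ?gt_eqF// mul1e Lp_on_pos.
apply: lee_wpmul2l; first by rewrite lee_fin ltW.
rewrite -(Lp_on_pos f0) -(Lp_on_pos g0).
apply: Lnorm_le_add => //; [exact: measurable_funM|..|]; try exact: on_pos_ge0.
  by move=> t; rewrite mulr_ge0 ?invr_ge0 ?(ltW C0)// on_pos_ge0.
move=> t; rewrite ler_pdivrMl//; rewrite /on_pos; case: ifPn => [/hfg//|_].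
by rewrite addr0 mulr0.
Qed.

Lemma Lp_Hardy (c q : R) f F : 0 < c -> 0 <= q < 1 ->
  measurable_fun setT (on_pos F) ->
  (forall t, 0 < t -> 0 <= F t) -> (forall t, 0 < t -> 0 <= f t) ->
  (forall t, 0 < t -> f t <= F t + q * f (c * t)) ->
  (forall t e, 0 < t -> 0 < e -> exists n, q ^+ n * f (c ^+ n * t) <= e) ->
  (Lp f <= ((1 - q)^-1)%:E * Lp F)%E.
Proof.
move=> c0 q01 mF F0 f0 fF fq; rewrite -(Lp_on_pos f0) -(Lp_on_pos F0).
have iterE n t : iter n (dilation c) t = c ^+ n * t.
  by elim: n => [|n IH]; rewrite ?expr0 ?mul1r//= IH /dilation exprS mulrA.
apply: (@Lnorm_Hardy _ _ _ _ (dilation c)) => //.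
- exact: measurable_dilation.
- by move=> A mA; exact: dt_over_t_dilation.
- exact: on_pos_ge0.
- exact: on_pos_ge0.
- move=> t; rewrite /on_pos /dilation pmulr_rgt0//.
  by case: ifPn => [/fF//|_]; rewrite mulr0 addr0.
- move=> t e e0; rewrite /on_pos; have [t0|t0] := boolP (0 < t).
    have [n fn] := fq t e t0 e0; exists n.
    by rewrite iterE pmulr_rgt0 ?exprn_gt0// t0.
  by exists 0%N; rewrite /= (negbTE t0) mulr0 ltW.
Qed.

(** L^p controls L^oo for functions that vary slowly on dyadic intervals. *)
Lemma le_Lp_dyadic (s a : R) F : 0 < s -> 0 <= a ->
  (forall t, 0 < t -> 0 <= F t) -> (forall t, s <= t <= 2 * s -> a <= F t) ->
  ((a / 2)%:E <= Lp F)%E.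
Proof.
move=> s0 a0 F0 aF; pose I := `[s, 2 * s]%classic.
have mI0 : measurable I by exact: measurable_itv.
have mI : measurable_fun [set: R] (\1_I : R -> R) by exact: measurable_indic.
have GF : (Lp (fun t : R => (a * \1_I t)%R) <= Lp F)%E.
  apply: le_Lp => t t0; rewrite indicE.
  have [/set_mem/= tI|_] := boolP (t \in I).
    by rewrite mulr1 a0/= aF//; move: tI; rewrite in_itv/=.
  by rewrite mulr0 lexx F0.
apply: le_trans GF; rewrite LnormZ_ge0// EFinM; apply: lee_wpmul2l.
  by rewrite lee_fin.
have := dt_over_t_dyadic s0; rewrite -/I => I2.
have I0 : (0 < dt_over_t I)%E by apply: lt_le_trans I2; rewrite lte_fin.
rewrite unlock /Lnorm; case: p p1 => [r| |]//.
- rewrite lee_fin => r1; have r0 : 0 < r by rewrite (lt_le_trans _ r1).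
  have -> : (\int[dt_over_t (R:=R)]_x `|(EFin \o \1_I) x| `^ r)%E = dt_over_t I.
    rewrite -[in RHS](setIT I) -integral_indic//; apply: eq_integral => t _ /=.
    rewrite indicE; case: (_ \in _); first by rewrite normr1 powR1.
    by rewrite normr0 powR0// gt_eqF.
  apply: le_trans (le_poweR _ _ I2); rewrite ?invr_ge0 ?(ltW r0) ?lee_fin//.
  rewrite -[leLHS]powRr1// ger_powR// ?invf_le1//; first lra.
- move=> _; rewrite ifT; last first.
    by apply: lt_le_trans I0 _; apply: le_measure; rewrite ?inE.
  (* otherwise I, where the indicator is 1, would be a null set *)
  rewrite leNgt; apply/negP => I1.
  have [N [mN N0 NI]] := ess_sup_ge (dt_over_t (R:=R)) (abse \o (EFin \o \1_I)).
  move: I0; rewrite -N0 ltNge => /negP; apply.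
  apply: le_measure; rewrite ?inE// => t It; apply: NI => /= t1.
  move: (le_lt_trans t1 I1).
  by rewrite indicE mem_set// normr1 lte_fin => h; lra.
Qed.

End Lp_norms_for_dt_over_t.

(** * Real-valued norms over real or complex scalars *)

Section real_valued_norm.
Variables (R : realType) (K : numFieldType) (S : scalars R K).
Implicit Types (V : normedModType K).

Lemma scalar_re_ge0 (x : K) : 0 <= x -> 0 <= scalar_re S x.
Proof. by case: S x => //= -[a b]; rewrite lecE/= => /andP[]. Qed.

Lemma scalar_reD (x y : K) : scalar_re S (x + y) = scalar_re S x + scalar_re S y.
Proof. by case: S x y => //= -[a b] [c d]. Qed.

Lemma le_scalar_re (x y : K) : x <= y -> scalar_re S x <= scalar_re S y.
Proof. by case: S x y => //= -[a b] [c d]; rewrite lecE/= => /andP[]. Qed.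

Lemma scalar_reM_ge0 (x y : K) : 0 <= x ->
  scalar_re S (x * y) = scalar_re S x * scalar_re S y.
Proof.
case: S x y => //= -[a b] [c d]; rewrite lecE/= => /andP[/eqP -> _].
by rewrite mul0r subr0.
Qed.

Lemma scalar_re0 : scalar_re S 0 = 0.
Proof. by case: S. Qed.

Lemma scalar_re_gt0 (x : K) : 0 < x -> 0 < scalar_re S x.
Proof. by case: S x => //= -[a b]; rewrite ltcE/= => /andP[]. Qed.

Lemma ge0_ltr_scalar_re (x e : K) : 0 <= x -> 0 < e ->
  (scalar_re S x < scalar_re S e) = (x < e).
Proof.
case: S x e => //= -[a b] [c d]; rewrite lecE ltcE/= => /andP[/eqP -> _].
by move=> /andP[/eqP -> _]; rewrite ltcE/= eqxx.
Qed.

Lemma scalar_re_surj (e : R) : 0 < e -> exists2 e' : K, 0 < e' & scalar_re S e' = e.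
Proof.
case: S => /= e0; first by exists e.
by exists (e%:C)%C => //; rewrite ltcE/= eqxx.
Qed.

Lemma rnorm_ge0 V (x : V) : 0 <= rnorm S x.
Proof. exact: scalar_re_ge0. Qed.

Lemma rnorm0 V : rnorm S (0 : V) = 0.
Proof. by rewrite /rnorm normr0 scalar_re0. Qed.

Lemma rnorm_eq0 V (x : V) : rnorm S x = 0 -> x = 0.
Proof.
have [//|] := eqVneq x 0; rewrite -normr_gt0 => /scalar_re_gt0.
by rewrite -/(rnorm S x) => /[swap] ->; rewrite ltxx.
Qed.

Lemma ler_rnormD V (x y : V) : rnorm S (x + y) <= rnorm S x + rnorm S y.
Proof. by rewrite -scalar_reD; apply/le_scalar_re/ler_normD. Qed.

Lemma rnormN V (x : V) : rnorm S (- x) = rnorm S x.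
Proof. by rewrite /rnorm normrN. Qed.

Lemma rnormB V (x y : V) : rnorm S (x - y) = rnorm S (y - x).
Proof. by rewrite /rnorm distrC. Qed.

Lemma ler_rnormB V (x y : V) : rnorm S (x - y) <= rnorm S x + rnorm S y.
Proof. by rewrite -(rnormN y) ler_rnormD. Qed.

Lemma ler_rnorm_distD V (z x y : V) :
  rnorm S (x - y) <= rnorm S (x - z) + rnorm S (z - y).
Proof. by rewrite (le_trans _ (ler_rnormD _ _))// addrA subrK. Qed.

Lemma rnormZ V (a : K) (x : V) : rnorm S (a *: x) = scalar_re S `|a| * rnorm S x.
Proof. by rewrite /rnorm normrZ scalar_reM_ge0. Qed.

Lemma cvg_rnormP V (T : Type) (F : set_system T) (FF : Filter F) (f : T -> V)
    (l : V) :
  f @ F --> l <-> forall e : R, 0 < e -> \forall t \near F, rnorm S (f t - l) < e.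
Proof.
rewrite -[f @ F]/((fun t => f t) @ F); split=> [/cvgrPdist_lt fl e e0|fl].
  have [e' e'0 <-] := scalar_re_surj e0.
  have := fl _ e'0; apply: filterS => t; rewrite distrC.
  by rewrite -ge0_ltr_scalar_re.
apply/cvgrPdist_lt => e e0.
have := fl _ (scalar_re_gt0 e0); apply: filterS => t.
by rewrite ge0_ltr_scalar_re// distrC.
Qed.

Lemma rnorm_cauchy_cvg (V : completeNormedModType K) (f : R -> V) :
  (forall e, 0 < e -> exists2 d, 0 < d &
    forall s t, 0 < s < d -> 0 < t < d -> rnorm S (f s - f t) < e) ->
  cvg (f t @[t --> 0^'+]).
Proof.
move=> fC; apply: cauchy_cvg; apply: cauchy_exP => e e0.
have [d d0 fd] := fC _ (scalar_re_gt0 e0).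
exists (f (d / 2)); rewrite /fmap/=; near=> t.
rewrite -ball_normE/= -(ge0_ltr_scalar_re (normr_ge0 _) e0).
apply: fd; first by apply/andP; split; lra.
apply/andP; split; first by near: t; exact: nbhs_right_gt.
by near: t; exact: nbhs_right_lt.
Unshelve. all: by end_near. Qed.

Lemma linear_rnorm_bounded (V W : normedModType K) (f : {linear V -> W}) :
  continuous f -> exists2 C : R, 0 < C & forall x, rnorm S (f x) <= C * rnorm S x.
Proof.
move=> /linear_bounded_continuous/linear_boundedP/pinfty_ex_gt0[M M0 fM].
exists (scalar_re S M); first exact: scalar_re_gt0.
by move=> x; rewrite -scalar_reM_ge0 ?(ltW M0)//; exact/le_scalar_re/fM.
Qed.

End real_valued_norm.

(** * The K-functional *)

Section K_functional_properties.
Variables (R : realType) (K : numFieldType) (S : scalars R K).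
Variables (X0 X1 : completeNormedModType K) (i : {linear X1 -> X0}).
Implicit Types (D : set X1) (t : R) (u : X0) (w : X1).

Notation KD := (K_functional S i).

Lemma K_functional_le D t u w : 0 <= t -> D w ->
  KD D t u <= rnorm S (u - i w) + t * rnorm S w.
Proof.
move=> t0 Dw; apply: ge_inf; last first.
  by exists (u - i w), w; split=> //; rewrite subrK.
exists 0 => _ [u0 [u1 [_ _ ->]]].
by rewrite addr_ge0 ?mulr_ge0 ?rnorm_ge0.
Qed.

Lemma le_K_functional D t u (b : R) : D 0 ->
  (forall w, D w -> b <= rnorm S (u - i w) + t * rnorm S w) -> b <= KD D t u.
Proof.
move=> D0 bD; apply: lb_le_inf.
  by exists (rnorm S u + t * rnorm S (0 : X1)), u, 0; rewrite linear0 addr0.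
by move=> _ [u0 [u1 [Du1 uE ->]]]; have := bD _ Du1; rewrite uE addrK.
Qed.

Lemma K_functional_ge0 D t u : D 0 -> 0 <= t -> 0 <= KD D t u.
Proof.
move=> D0 t0; apply: le_K_functional => // w _.
by rewrite addr_ge0 ?mulr_ge0 ?rnorm_ge0.
Qed.

Lemma K_functional_le_rnorm D t u : D 0 -> 0 <= t -> KD D t u <= rnorm S u.
Proof.
move=> D0 t0; have := K_functional_le u t0 D0.
by rewrite linear0 rnorm0 mulr0 addr0 subr0.
Qed.

Lemma K_functional_homo D s t u : D 0 -> 0 <= s -> s <= t ->
  KD D s u <= KD D t u.
Proof.
move=> D0 s0 st; apply: le_K_functional => // w Dw.
by rewrite (le_trans (K_functional_le u s0 Dw))// lerD2l ler_wpM2r ?rnorm_ge0.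
Qed.

(** With [K_functional_homo], this shows that K(t,u) changes by a bounded
    factor between comparable scales. *)
Lemma K_functional_dilation D (l t : R) u : D 0 -> 1 <= l -> 0 <= t ->
  KD D (l * t) u <= l * KD D t u.
Proof.
move=> D0 l1 t0; have l0 : 0 < l by lra.
rewrite -ler_pdivrMl//; apply: le_K_functional => // w Dw.
rewrite ler_pdivrMl// (le_trans (K_functional_le u _ Dw)) ?mulr_ge0 ?(ltW l0)//.
by rewrite mulrDr mulrA lerD2r ler_peMl ?rnorm_ge0.
Qed.

Lemma K_functional_setT_le D t u : D 0 -> 0 <= t -> KD setT t u <= KD D t u.
Proof.
by move=> D0 t0; apply: le_K_functional => // w _; exact: K_functional_le.
Qed.

Lemma K_functional_linear D t (a : K) u v : D 0 ->
  (forall w1 w2, D w1 -> D w2 -> D (a *: w1 + w2)) -> 0 <= t ->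
  KD D t (a *: u + v) <= scalar_re S `|a| * KD D t u + KD D t v.
Proof.
move=> D0 DZD t0; rewrite -lerBlDl; apply: le_K_functional => // w2 Dw2.
have [a0|a0] := eqVneq a 0.
  rewrite a0 scale0r add0r normr0 scalar_re0 mul0r subr0.
  exact: K_functional_le.
have {}a0 : 0 < scalar_re S `|a| by apply: scalar_re_gt0; rewrite normr_gt0.
rewrite lerBlDr -lerBlDl -ler_pdivrMl//; apply: le_K_functional => // w1 Dw1.
rewrite ler_pdivrMl// lerBlDl.
apply: le_trans (K_functional_le _ t0 (DZD _ _ Dw1 Dw2)) _.
have uv : rnorm S (a *: u + v - i (a *: w1 + w2)) <=
    scalar_re S `|a| * rnorm S (u - i w1) + rnorm S (v - i w2).
  by rewrite -rnormZ linearD linearZ/= opprD addrACA -scalerBr ler_rnormD.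
have w12 : rnorm S (a *: w1 + w2) <= scalar_re S `|a| * rnorm S w1 + rnorm S w2.
  by rewrite -rnormZ ler_rnormD.
have := ler_wpM2l t0 w12; lra.
Qed.

(** The K-functional is nondecreasing in t. *)
Lemma measurable_weighted_K_functional D (a : R) u : D 0 ->
  measurable_fun setT (on_pos (fun t => t `^ a * KD D t u)).
Proof.
move=> D0.
rewrite (_ : on_pos _ = (fun t => t `^ a * on_pos (fun t => KD D t u) t)).
  apply: measurable_funM; first exact: measurable_powR.
  apply: nondecreasing_measurable => // s t st; rewrite /on_pos.
  case: ifPn => s0; last by case: ifPn => // t0; rewrite K_functional_ge0 ?(ltW t0).
  by rewrite (lt_le_trans s0 st); apply: K_functional_homo => //; exact: ltW.
by apply/funext => t; rewrite /on_pos; case: ifPn; rewrite ?mulr0.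
Qed.

End K_functional_properties.

(** * Comparison of the K-functionals at a fixed scale *)

Section pointwise_estimates.
Variables (R : realType) (K : numFieldType) (S : scalars R K).
Variables (X0 X1 : completeNormedModType K) (i : {linear X1 -> X0}).
Hypothesis i_cont : continuous i.
Variable Lambda : R -> {linear X0 -> X1}.
Hypothesis Lambda_lin : linearisable S i Lambda.
Variables (theta0 : R) (D : submodClosed X1).
Variables (Y : completeNormedModType K) (j : {linear quot_mod D -> Y}).
Hypothesis D_order : interpolation_order S i Lambda j theta0.

Notation KT := (K_functional S i setT).
Notation KD := (K_functional S i [set` D]).
Notation PL t u := (quot_proj j (Lambda t u)).
Notation NJ := (quotient_J_norm S i [set` D]).

Let D0 : [set` D] 0.
Proof. exact: (rpred0 D). Qed.

Let J_ge0 t w : 0 <= t -> 0 <= J_functional S i t w.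
Proof. by move=> t0; rewrite addr_ge0 ?mulr_ge0 ?rnorm_ge0. Qed.

Lemma quotient_J_norm_le t w v : 0 <= t -> v \in D ->
  NJ t w <= J_functional S i t (w - v).
Proof.
move=> t0 vD; apply: ge_inf; last by exists v.
by exists 0 => _ [v' _ <-]; exact: J_ge0.
Qed.

Lemma le_quotient_J_norm t w b :
  (forall v, v \in D -> b <= J_functional S i t (w - v)) -> b <= NJ t w.
Proof.
move=> bJ; apply: lb_le_inf; first by exists (J_functional S i t (w - 0)), 0.
by move=> _ [v vD <-]; exact: bJ.
Qed.

Lemma quot_proj_linear : linear (quot_proj j).
Proof. by move=> a x y; rewrite /quot_proj linearP linearP. Qed.

Lemma quot_projB x y : quot_proj j (x - y) = quot_proj j x - quot_proj j y.
Proof.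
by rewrite -[x - y]addrC -scaleN1r quot_proj_linear scaleN1r addrC.
Qed.

Lemma linearisable_le : exists2 C : R, 0 < C & forall t u, 0 < t <= 1 ->
  rnorm S (u - i (Lambda t u)) + t * rnorm S (Lambda t u) <= C * KT t u.
Proof.
have [C1 [C2 [C10 _ H]]] := Lambda_lin.
exists C1^-1; first by rewrite invr_gt0.
by move=> t u t01; rewrite ler_pdivlMl//; have /andP[] := H t u t01.
Qed.

(** At scale 1 the K-functional is equivalent to the norm of X0, since X1
    embeds continuously in X0. *)
Lemma rnorm_le_K1 : exists2 C : R, 0 < C & forall u, rnorm S u <= C * KT 1 u.
Proof.
have [C C0 iC] := linear_rnorm_bounded S i_cont.
exists (1 + C); first lra.
move=> u; rewrite -ler_pdivrMl; last lra.
apply: le_K_functional => // w _; rewrite ler_pdivrMl; last lra.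
have := ler_rnormD S (u - i w) (i w); rewrite subrK.
have := iC w; have := rnorm_ge0 S w; have := rnorm_ge0 S (u - i w); nra.
Qed.

(** For t >= 1 one can take the decomposition u = u + 0. *)
Lemma KD_le_KT_large : exists2 C : R, 0 < C & forall t u, 1 <= t ->
  KD t u <= C * KT t u.
Proof.
have [C C0 uC] := rnorm_le_K1; exists C => // t u t1.
have t0 : 0 <= t by lra.
rewrite (le_trans (K_functional_le_rnorm S i u D0 t0))//.
rewrite (le_trans (uC u))// ler_wpM2l ?(ltW C0)//.
by apply: K_functional_homo.
Qed.

(** A crude bound, which only serves for t bounded away from 0. *)
Lemma KD_le_KT_small : exists2 C : R, 0 < C & forall t u, 0 < t <= 1 ->
  t * KD t u <= C * KT t u.
Proof.
have [C C0 uC] := rnorm_le_K1; exists C => // t u /andP[t0 t1].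
rewrite -ler_pdivlMl// (le_trans (K_functional_le_rnorm S i u D0 (ltW t0)))//.
rewrite (le_trans (uC u))// mulrCA ler_wpM2l ?(ltW C0)//.
have := @K_functional_dilation _ _ S _ _ i setT t^-1 t u I.
by rewrite mulVf ?gt_eqF//; apply; rewrite ?(ltW t0)// invf_ge1.
Qed.

(** For v in D the J-functional of Lambda(t) u - v is at most the cost of
    the decomposition u = (u - v) + v plus that of u = (u - Lambda(t) u) +
    Lambda(t) u, and the latter is bounded by K(t,u) <= K~(t,u). *)
Lemma trace_le_KD : exists2 C : R, 0 < C & forall t u, 0 < t <= 1 ->
  t `^ theta0 * rnorm S (PL t u) <= C * KD t u.
Proof.
have [C C0 HC] := linearisable_le.
have [_ /(_ 1 (lexx _))[c1 [c2 [c10 _ Hc]]]] := D_order.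
exists (c1^-1 * (C + 1)); first by rewrite mulr_gt0 ?invr_gt0//; lra.
move=> t u t01; rewrite -mulrA ler_pdivlMl//.
have := Hc t t u 0 t01 t01; rewrite invr1 mul1r lexx => /(_ isT) /andP[].
rewrite linear0 addr0 => h _; apply: (le_trans h).
move: (t01) => /andP[t0 _].
rewrite mulrDl mul1r -lerBlDl; apply: le_K_functional => // v vD.
rewrite lerBlDl.
apply: le_trans (quotient_J_norm_le (Lambda t u) (ltW t0) vD) _.
rewrite /J_functional.
have h1 : rnorm S (i (Lambda t u - v)) <=
    rnorm S (u - i (Lambda t u)) + rnorm S (u - i v).
  rewrite linearB/= (le_trans (ler_rnorm_distD S u _ _))//.
  by rewrite (rnormB S _ u).
have h2 := ler_wpM2l (ltW t0) (ler_rnormB S (Lambda t u) v).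
have h3 := HC t u t01.
have h4 := ler_wpM2l (ltW C0) (K_functional_setT_le S i u D0 (ltW t0)).
by move: h1 h2 h3 h4; lra.
Qed.

(** Any v in D that is close to Lambda(t) u for the J-functional gives a
    decomposition u = (u - v) + v for the smaller couple. *)
Lemma KD_le_trace : exists2 C : R, 0 < C & forall t u, 0 < t <= 1 ->
  KD t u <= C * (KT t u + t `^ theta0 * rnorm S (PL t u)).
Proof.
have [C C0 HC] := linearisable_le.
have [_ /(_ 1 (lexx _))[c1 [c2 [_ c20 Hc]]]] := D_order.
exists (C + c2); first lra.
move=> t u t01; move: (t01) => /andP[t0 _].
have := Hc t t u 0 t01 t01; rewrite invr1 mul1r lexx => /(_ isT) /andP[_].
rewrite linear0 addr0 => h.
have {}h : KD t u - C * KT t u <= c2 * (t `^ theta0 * rnorm S (PL t u)).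
  apply: le_trans h; apply: le_quotient_J_norm => v vD.
  rewrite lerBlDl /J_functional.
  apply: le_trans (K_functional_le S i u (ltW t0) vD) _.
  have h1 : rnorm S (u - i v) <=
      rnorm S (u - i (Lambda t u)) + rnorm S (i (Lambda t u - v)).
    by rewrite linearB/= ler_rnorm_distD.
  have h2 : rnorm S v <= rnorm S (Lambda t u) + rnorm S (Lambda t u - v).
    by rewrite -{1}(subKr (Lambda t u) v) ler_rnormB.
  have h3 := ler_wpM2l (ltW t0) h2.
  have := HC t u t01; lra.
have KT0 : 0 <= KT t u by apply: K_functional_ge0 => //; exact: ltW.
have tr0 : 0 <= t `^ theta0 * rnorm S (PL t u).
  by rewrite mulr_ge0 ?powR_ge0 ?rnorm_ge0.
by move: h KT0 tr0; nra.
Qed.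

(** Here the interpolation order is used at two different scales: both
    Lambda(t) u and Lambda(s) u are within K(t,u) of u in X0, so their
    difference is small for the J-functional. *)
Lemma trace_difference_le : exists2 C : R, 0 < C & forall s t u,
  0 < s <= 1 -> 0 < t <= 1 -> s <= 2 * t -> t <= 2 * s ->
  t `^ theta0 * rnorm S (PL t u - PL s u) <= C * KT t u.
Proof.
have [C C0 HC] := linearisable_le.
have [_ H2] := D_order.
have [|c1 [c2 [c10 _ Hc]]] := H2 2; first lra.
exists (c1^-1 * (5 * C)); first by rewrite mulr_gt0 ?invr_gt0//; lra.
move=> s t u s01 t01 st ts; rewrite -mulrA ler_pdivlMl//.
have := Hc s t u (- u) s01 t01; rewrite ts andbT ler_pdivrMl// => /(_ st).
rewrite linearN/= => /andP[h _]; rewrite -quot_projB; apply: (le_trans h).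
move: (t01) (s01) => /andP[t0 _] /andP[s0 _].
apply: le_trans (quotient_J_norm_le _ (ltW t0) (rpred0 D)) _.
rewrite subr0 /J_functional linearB/=.
have h1 : rnorm S (i (Lambda t u) - i (Lambda s u)) <=
    rnorm S (u - i (Lambda t u)) + rnorm S (u - i (Lambda s u)).
  by rewrite (le_trans (ler_rnorm_distD S u _ _))// (rnormB S _ u).
have h2 := ler_wpM2l (ltW t0) (ler_rnormB S (Lambda t u) (Lambda s u)).
have h3 := ler_wpM2r (rnorm_ge0 S (Lambda s u)) ts.
have h4 := HC t u t01. have h5 := HC s u s01.
have h6 : KT s u <= 2 * KT t u.
  apply: (@le_trans _ _ (KT (2 * t) u)).
    by apply: K_functional_homo => //; exact: ltW.
  by apply: K_functional_dilation => //; [lra|exact: ltW].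
have h7 := ler_wpM2l (ltW C0) h6.
have h8 := rnorm_ge0 S (u - i (Lambda s u)).
by move: h1 h2 h3 h4 h5 h7 h8; lra.
Qed.

End pointwise_estimates.

(** * Real powers and dyadic scales *)

Section powers.
Variable R : realType.
Implicit Types t a b c d e : R.

Lemma powR_pos_D t a b : 0 < t -> t `^ (a + b) = t `^ a * t `^ b.
Proof. by move=> t0; rewrite powRD// (gt_eqF t0) implybT. Qed.

Lemma powR_dilation c t a : 0 < c -> 0 < t -> t `^ a = c `^ (- a) * (c * t) `^ a.
Proof.
move=> c0 t0; rewrite powRM ?(ltW c0) ?(ltW t0)// mulrA -powR_pos_D// addNr.
by rewrite powRr0 mul1r.
Qed.

Lemma powR_near0 a e : 0 < a -> 0 < e ->
  exists2 d, 0 < d <= 1 & forall t, 0 < t < d -> t `^ a < e.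
Proof.
move=> a0 e0; exists (Num.min 1 (e `^ a^-1)).
  by rewrite lt_min ltr01 powR_gt0//= ge_min lexx.
move=> t /andP[t0]; rewrite lt_min => /andP[_ te].
have -> : e = (e `^ a^-1) `^ a by rewrite -powRrM mulVf ?gt_eqF// powRr1// ltW.
by rewrite gt0_ltr_powR// nnegrE ?powR_ge0// ltW.
Qed.

Lemma powR_exprn c a n : 0 < c -> (c ^+ n) `^ a = (c `^ a) ^+ n.
Proof.
by move=> c0; rewrite -!powR_mulrn ?powR_ge0 ?(ltW c0)// -!powRrM mulrC.
Qed.

Lemma half_powR_lt1 a : 0 < a -> (2^-1 : R) `^ a < 1.
Proof.
move=> a0; have := @gt0_ltr_powR R a a0 2^-1 1.
by rewrite powR1; apply; rewrite ?nnegrE//; lra.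
Qed.

Lemma half_powRE a : (2^-1 : R) `^ a = 2 `^ (- a).
Proof. by rewrite -powR_inv1// -powRrM mulN1r. Qed.

Lemma exists_exp2_gt c : exists n, c < 2 ^+ n.
Proof.
exists (Num.bound c); apply: le_lt_trans (ler_norm c) _.
apply: lt_trans (archi_boundP (normr_ge0 _)) _.
have -> : Num.bound `|c| = Num.bound c.
  by rewrite /Num.bound normr_id.
by rewrite -natrX ltr_nat ltn_expl.
Qed.

Lemma exists_half_exp_lt t d : 0 < d -> exists n, 2^-1 ^+ n * t < d.
Proof.
move=> d0; have [n tn] := exists_exp2_gt (t / d); exists n.
by rewrite exprVn ltr_pdivrMl ?exprn_gt0// -ltr_pdivrMr.
Qed.

End powers.

(** * Interpolation norms *)

Section integrated_estimates.
Variables (R : realType) (K : numFieldType) (S : scalars R K).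
Variables (X0 X1 : completeNormedModType K) (i : {linear X1 -> X0}).
Variables (theta : R) (p : \bar R).
Hypothesis theta01 : 0 < theta < 1.
Hypothesis p1 : (1 <= p)%E.

Notation wK A u := (fun t : R => t `^ (- theta) * K_functional S i A t u).
Notation Lp f := ('N[dt_over_t (R := R)]_p[EFin \o f])%E.

Lemma interp_normE (A : set X1) u : interp_norm S i A theta p u = Lp (wK A u).
Proof. by []. Qed.

Lemma wK_ge0 (A : set X1) u : A 0 -> forall t, 0 < t -> 0 <= wK A u t.
Proof.
by move=> A0 t t0; rewrite mulr_ge0 ?powR_ge0 ?K_functional_ge0// ltW.
Qed.

(** The embedding of the (theta,p) space in the (theta,oo) space: on
    [t, 2t] the weighted K-functional is at least half its value at t. *)
Lemma K_le_interp_norm (A : set X1) u t : A 0 -> 0 < t ->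
  ((wK A u t / 4)%:E <= interp_norm S i A theta p u)%E.
Proof.
move=> A0 t0; rewrite interp_normE; have /andP[th0 th1] := theta01.
have K0 := K_functional_ge0 S i u A0 (ltW t0).
apply: (@le_trans _ _ (((2 * t) `^ (- theta) * K_functional S i A t u) / 2)%:E).
  rewrite lee_fin (_ : 4 = 2 * 2 :> R); last by ring.
  rewrite invfM mulrA; apply: ler_wpM2r; first by rewrite invr_ge0.
  rewrite ler_pdivrMr// mulrAC ler_wpM2r//.
  rewrite powRM// ?(ltW t0)// mulrAC ler_peMl ?powR_ge0//.
  rewrite -{2}(@powRr1 _ 2)// -powR_pos_D// -[leLHS](@powRr0 _ 2).
  by rewrite ler_powR//; lra.
apply: (le_Lp_dyadic p1 t0).
- by rewrite mulr_ge0 ?powR_ge0.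
- exact: wK_ge0.
move=> r /andP[tr r2t]; apply: ler_pM; rewrite ?powR_ge0//.
  rewrite !powRN lef_pV2 ?posrE ?powR_gt0//; [|lra..].
  by apply: ge0_ler_powR; rewrite ?nnegrE//; lra.
by apply: K_functional_homo => //; exact: ltW.
Qed.

Lemma interp_norm_setT_le (A : set X1) u : A 0 ->
  (interp_norm S i setT theta p u <= interp_norm S i A theta p u)%E.
Proof.
move=> A0; rewrite !interp_normE; apply: le_Lp => // t t0.
rewrite wK_ge0//= ler_wpM2l ?powR_ge0//.
by apply: K_functional_setT_le => //; exact: ltW.
Qed.

Lemma interp_space0 (A : set X1) : A 0 -> interp_space S i A theta p 0.
Proof.
move=> A0; rewrite /interp_space/= interp_normE.
have h : (Lp (wK A 0%R) <= Lp (fun _ : R => 0%R))%E.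
  apply: le_Lp => // t t0; rewrite wK_ge0//= pmulr_rle0 ?powR_gt0//.
  by have := K_functional_le_rnorm S i 0 A0 (ltW t0); rewrite rnorm0.
apply: le_lt_trans h _.
by rewrite (_ : EFin \o _ = cst 0%E)// Lnorm0// gt_eqF// (lt_le_trans _ p1).
Qed.

Lemma interp_space_linear (A : set X1) (a : K) u v : A 0 ->
  (forall w1 w2, A w1 -> A w2 -> A (a *: w1 + w2)) ->
  interp_space S i A theta p u -> interp_space S i A theta p v ->
  interp_space S i A theta p (a *: u + v).
Proof.
move=> A0 AZD; rewrite /interp_space/= !interp_normE => Nu Nv.
have a0 : 0 <= scalar_re S `|a| by exact: scalar_re_ge0.
have h : (Lp (wK A (a *: u + v)%R) <=
    (scalar_re S `|a| + 1)%R%:E * (Lp (wK A u) + Lp (wK A v)))%E; last first.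
  apply: le_lt_trans h _; rewrite lte_mul_pinfty ?lte_add_pinfty// lee_fin.
  by rewrite addr_ge0.
apply: Lp_le_add => //; try exact: wK_ge0;
  try exact: measurable_weighted_K_functional; first lra.
move=> t t0 /=; rewrite -mulrDr mulrCA; apply: ler_wpM2l; first exact: powR_ge0.
apply: le_trans (K_functional_linear S i u v A0 AZD (ltW t0)) _.
have := K_functional_ge0 S i u A0 (ltW t0).
have := K_functional_ge0 S i v A0 (ltW t0); nra.
Qed.

End integrated_estimates.

(** * The norm of the trace *)

Section trace_estimates.
Variables (R : realType) (K : numFieldType) (S : scalars R K).
Variables (X0 X1 : completeNormedModType K) (i : {linear X1 -> X0}).
Hypothesis i_cont : continuous i.
Variable Lambda : R -> {linear X0 -> X1}.
Hypothesis Lambda_lin : linearisable S i Lambda.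
Variables (theta0 : R) (D : submodClosed X1).
Variables (Y : completeNormedModType K) (j : {linear quot_mod D -> Y}).
Hypothesis D_order : interpolation_order S i Lambda j theta0.
Variables (theta : R) (p : \bar R).
Hypothesis theta01 : 0 < theta < 1.
Hypothesis p1 : (1 <= p)%E.

Notation KT := (K_functional S i setT).
Notation KD := (K_functional S i [set` D]).
Notation PL t u := (quot_proj j (Lambda t u)).
Notation N := (interp_norm S i setT theta p).
Notation NT := (interp_norm S i [set` D] theta p).
Notation TN := (trace_norm S Lambda j theta0 theta p).
Notation Lp f := ('N[dt_over_t (R := R)]_p[EFin \o f])%E.
Notation wK A u := (fun t : R => t `^ (- theta) * K_functional S i A t u).

Let D0 : [set` D] 0.
Proof. exact: (rpred0 D). Qed.

(** The function of t whose L^p norm is the second term of the norm. *)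
Definition trace u : R -> R :=
  (fun t => rnorm S (PL t u) * t `^ (theta0 - theta)) \_ `[0, 1].

Lemma trace_normE u : TN u = Lp (trace u).
Proof.
by apply: eq_Lnorm => t; rewrite /trace /patch/=; case: ifPn.
Qed.

Lemma traceE u t : 0 < t ->
  trace u t = if t <= 1 then rnorm S (PL t u) * t `^ (theta0 - theta) else 0.
Proof.
move=> t0; rewrite /trace /patch; congr (if _ then _ else _).
by rewrite mem_setE in_itv/= (ltW t0).
Qed.

Lemma trace_ge0 u t : 0 < t -> 0 <= trace u t.
Proof.
move=> t0; rewrite traceE//; case: ifPn => // _.
by rewrite mulr_ge0 ?powR_ge0 ?rnorm_ge0.
Qed.

Lemma trace_weightE t (x : R) : 0 < t ->
  x * t `^ (theta0 - theta) = t `^ (- theta) * (t `^ theta0 * x).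
Proof. by move=> t0; rewrite powR_pos_D// mulrC; ring. Qed.

Lemma trace_norm_le_interp_norm : exists2 C : R, 0 < C &
  forall u, (TN u <= C%:E * NT u)%E.
Proof.
have [C C0 HC] := trace_le_KD Lambda_lin D_order.
exists C => // u; rewrite trace_normE interp_normE; apply: Lp_le_scale => //.
- exact: ltW.
- exact: measurable_weighted_K_functional.
- exact: wK_ge0.
move=> t t0; rewrite trace_ge0//= traceE//; case: ifPn => t1.
  rewrite trace_weightE// [leRHS]mulrCA ler_wpM2l ?powR_ge0// HC//.
  by rewrite t0.
by rewrite mulr_ge0 ?(ltW C0)// wK_ge0.
Qed.

(** The trace function may be nonmeasurable, hence the detour through
    [Lp_le_add], where it appears as the nonmeasurable summand. *)
Lemma interp_norm_le_trace_norm : exists2 C : R, 0 < C &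
  forall u, (NT u <= C%:E * (N u + TN u))%E.
Proof.
have [C C0 HC] := KD_le_trace Lambda_lin D_order.
have [C' C'0 HC'] := KD_le_KT_large S i_cont D.
exists (C + C'); first lra.
move=> u; rewrite trace_normE !interp_normE.
apply: Lp_le_add => //; try exact: measurable_weighted_K_functional;
  try exact: wK_ge0; try exact: trace_ge0; first lra.
move=> t t0; have K0 := K_functional_ge0 S i u (I : [set: X1] 0) (ltW t0).
rewrite traceE//; case: ifPn => t1.
  rewrite trace_weightE// -mulrDr [leRHS]mulrCA ler_wpM2l ?powR_ge0//.
  apply: (le_trans (HC t u _)); first by rewrite t0.
  rewrite ler_wpM2r//; last lra.
  by rewrite addr_ge0// mulr_ge0 ?powR_ge0 ?rnorm_ge0.
rewrite addr0 [leRHS]mulrCA ler_wpM2l ?powR_ge0//.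
apply: (le_trans (HC' t u _)); first lra.
by rewrite ler_wpM2r//; lra.
Qed.

(** The one-step recursion to which Hardy's inequality applies. *)
Lemma trace_step c : 2^-1 <= c <= 2 -> exists2 C : R, 0 < C &
  forall u t, 0 < t <= 1 -> c * t <= 1 ->
    trace u t <= C * wK setT u t + c `^ (theta - theta0) * trace u (c * t).
Proof.
move=> /andP[c1 c2]; have c0 : 0 < c by lra.
have [C C0 HC] := trace_difference_le Lambda_lin D_order.
exists C => // u t /andP[t0 t1] ct1; have ct0 : 0 < c * t by rewrite mulr_gt0.
rewrite !traceE// t1 ct1.
rewrite -(opprB theta0) (mulrCA (c `^ _)) -(powR_dilation _ c0 t0).
rewrite -lerBlDr -mulrBl.
have tri : rnorm S (PL t u) - rnorm S (PL (c * t) u) <=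
    rnorm S (PL t u - PL (c * t) u).
  by rewrite lerBlDr -{1}(subrK (PL (c * t) u) (PL t u)) ler_rnormD.
apply: le_trans (ler_wpM2r (powR_ge0 _ _) tri) _.
rewrite trace_weightE// [leRHS]mulrCA ler_wpM2l ?powR_ge0//.
by apply: HC; rewrite ?t0 ?ct0//; nra.
Qed.

(** This starts the upward recursion (c = 2): the next step would leave
    ]0, 1]. *)
Lemma trace_le_away_from_0 : exists2 C : R, 0 < C &
  forall u t, 2^-1 <= t <= 1 -> trace u t <= C * wK setT u t.
Proof.
have [C C0 HC] := trace_le_KD Lambda_lin D_order.
have [C' C'0 HC'] := KD_le_KT_small S i_cont D.
exists (C * (2 * C')); first by rewrite !mulr_gt0.
move=> u t /andP[t2 t1]; have t0 : 0 < t by lra.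
have t01 : 0 < t <= 1 by rewrite t0.
rewrite traceE// t1 trace_weightE// [leRHS]mulrCA ler_wpM2l ?powR_ge0//.
apply: (le_trans (HC t u t01)); rewrite -mulrA ler_wpM2l ?(ltW C0)//.
have := HC' t u t01.
have := K_functional_ge0 S i u D0 (ltW t0).
nra.
Qed.

Lemma Lp_trace_le_scale (C : R) u : 0 < C ->
  Lp (fun t : R => C * wK setT u t)%R = (C%:E * N u)%E.
Proof.
move=> C0; rewrite interp_normE.
have w0 := wK_ge0 S i theta u (I : [set: X1] 0).
rewrite -(Lp_on_pos p1 w0) -LnormZ_ge0// ?(ltW C0)//; last first.
  exact: measurable_weighted_K_functional.
rewrite -(Lp_on_pos p1) => [|t t0]; last by rewrite mulr_ge0 ?(ltW C0) ?w0.
by apply: eq_Lnorm => t /=; rewrite /on_pos; case: ifPn; rewrite ?mulr0.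
Qed.

Lemma measurable_scaled_wK (C : R) u :
  measurable_fun setT (on_pos (fun t => C * wK setT u t)).
Proof.
rewrite (_ : on_pos _ = (fun t => C * on_pos (wK setT u) t)).
  apply: measurable_funM => //.
  exact: measurable_weighted_K_functional.
by apply/funext => t; rewrite /on_pos; case: ifPn; rewrite ?mulr0.
Qed.

(** Hardy's inequality going up the scales: q = 2^(theta - theta0) < 1, and
    the remainder vanishes once 2^n t > 1. *)
Lemma trace_norm_le_below : theta < theta0 ->
  exists2 C : R, 0 < C & forall u, (TN u <= C%:E * N u)%E.
Proof.
move=> th; pose q : R := 2 `^ (theta - theta0).
have [C C0 HC] := @trace_step 2 ltac:(apply/andP; split; lra).
have [C' C'0 HC'] := trace_le_away_from_0.
have q1 : q < 1.
  by rewrite /q -(opprB theta0) -half_powRE half_powR_lt1// subr_gt0.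
have q0 : 0 <= q by exact: powR_ge0.
have CC : 0 < C + C' by lra.
exists ((1 - q)^-1 * (C + C')).
  by rewrite mulr_gt0// invr_gt0; lra.
move=> u; rewrite trace_normE EFinM -muleA -Lp_trace_le_scale//.
have w0 := wK_ge0 S i theta u (I : [set: X1] 0).
apply: (@Lp_Hardy _ _ p1 2) => //.
- by rewrite q0.
- exact: measurable_scaled_wK.
- by move=> t t0; rewrite mulr_ge0 ?(ltW CC) ?w0.
- exact: trace_ge0.
- move=> t t0; have {}w0 := w0 t t0.
  have tr2 : 0 <= q * trace u (2 * t) by rewrite mulr_ge0 ?trace_ge0//; lra.
  have [t1|t1] := leP t 1; last first.
    by rewrite {1}traceE// (lt_geF t1) addr_ge0// mulr_ge0// ltW.
  have [t2|t2] := leP (2 * t) 1.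
    apply: (le_trans (HC u t _ t2)); first by rewrite t0.
    by rewrite lerD2r ler_wpM2r//; lra.
  apply: (le_trans (HC' u t _)); first by apply/andP; split; lra.
  by apply: ler_wpDr => //; rewrite ler_wpM2r//; lra.
move=> t e t0 e0; have [n tn] := exists_exp2_gt t^-1; exists n.
have {}tn : 1 < 2 ^+ n * t by rewrite -ltr_pdivrMr// div1r.
by rewrite traceE ?mulr_gt0 ?exprn_gt0// (lt_geF tn) mulr0 ltW.
Qed.

(** Hardy's inequality going down the scales: q = 2^(theta0 - theta) < 1,
    and the remainder is t^(theta0 - theta) |Lambda(2^-n t) u|_Y. *)
Lemma trace_norm_le_above : theta0 < theta ->
  exists2 C : R, 0 < C & forall u, PL t u @[t --> 0^'+] --> 0 ->
    (TN u <= C%:E * N u)%E.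
Proof.
move=> th; pose q : R := 2^-1 `^ (theta - theta0).
have [C C0 HC] := @trace_step 2^-1 ltac:(apply/andP; split; lra).
have q1 : q < 1 by rewrite half_powR_lt1// subr_gt0.
have q0 : 0 <= q by exact: powR_ge0.
exists ((1 - q)^-1 * C).
  by rewrite mulr_gt0// invr_gt0; lra.
move=> u Pu; rewrite trace_normE EFinM -muleA -Lp_trace_le_scale//.
have w0 := wK_ge0 S i theta u (I : [set: X1] 0).
apply: (@Lp_Hardy _ _ p1 2^-1) => //.
- by rewrite q0.
- exact: measurable_scaled_wK.
- by move=> t t0; rewrite mulr_ge0 ?(ltW C0) ?w0.
- exact: trace_ge0.
- move=> t t0; have {}w0 := w0 t t0.
  have [t1|t1] := leP t 1; last first.
    have tr2 : 0 <= q * trace u (2^-1 * t) by rewrite mulr_ge0 ?trace_ge0//; lra.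
    by rewrite {1}traceE// (lt_geF t1) addr_ge0// mulr_ge0// ltW.
  by apply: HC; [rewrite t0|lra].
move=> t e t0 e0.
have a0 : 0 < t `^ (theta0 - theta) by exact: powR_gt0.
have e'0 : 0 < e / t `^ (theta0 - theta) by exact: divr_gt0.
have [d /= d0 Pd] := (cvg_rnormP S _ (fun t => PL t u) 0).1 Pu _ e'0.
have [|n tn] := @exists_half_exp_lt R t (Num.min d 1); first by rewrite lt_min d0/=.
exists n; have tn0 : 0 < 2^-1 ^+ n * t by rewrite mulr_gt0 ?exprn_gt0 ?invr_gt0.
move: tn; rewrite lt_min => /andP[tnd tn1].
rewrite traceE// (ltW tn1) mulrCA /q -powR_exprn ?invr_gt0//.
rewrite -(opprB theta0) -powR_dilation ?exprn_gt0 ?invr_gt0// -ler_pdivlMr//.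
have := Pd (2^-1 ^+ n * t); rewrite subr0 => h; apply/ltW/h => //.
by rewrite /ball_/= sub0r normrN gtr0_norm.
Qed.

End trace_estimates.

(** * The extension of the projection to the interpolation space *)

Section extension_of_the_projection.
Variables (R : realType) (K : numFieldType) (S : scalars R K).
Variables (X0 X1 : completeNormedModType K) (i : {linear X1 -> X0}).
Hypothesis i_cont : continuous i.
Variable Lambda : R -> {linear X0 -> X1}.
Hypothesis Lambda_lin : linearisable S i Lambda.
Variables (theta0 : R) (D : submodClosed X1).
Variables (Y : completeNormedModType K) (j : {linear quot_mod D -> Y}).
Hypothesis D_order : interpolation_order S i Lambda j theta0.
Variables (theta : R) (p : \bar R).
Hypothesis theta01 : 0 < theta < 1.
Hypothesis p1 : (1 <= p)%E.
Hypothesis theta0_lt : theta0 < theta.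

Notation KT := (K_functional S i setT).
Notation KD := (K_functional S i [set` D]).
Notation PL t u := (quot_proj j (Lambda t u)).
Notation X := (interp_space S i setT theta p).
Notation N := (interp_norm S i setT theta p).
Notation XT := (interp_space S i [set` D] theta p).
Notation NT := (interp_norm S i [set` D] theta p).

Definition proj_extension (u : X0) : Y := lim (PL t u @[t --> 0^'+]).

(** Conversion of bounds at the weights t^theta0 and t^-theta into a rate of
    decay in Y. *)
Lemma le_of_weighted (t x C k m : R) : 0 < t -> 0 <= C ->
  t `^ theta0 * x <= C * k -> t `^ (- theta) * k <= m ->
  x <= C * m * t `^ (theta - theta0).
Proof.
move=> t0 C0 xk km.
have -> : x = t `^ (- theta0) * (t `^ theta0 * x).
  by rewrite mulrA -powR_pos_D// addNr powRr0 mul1r.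
apply: le_trans (ler_wpM2l (powR_ge0 _ _) xk) _.
have -> : k = t `^ theta * (t `^ (- theta) * k).
  by rewrite mulrA -powR_pos_D// subrr powRr0 mul1r.
rewrite mulrCA (mulrA (t `^ (- theta0))) -powR_pos_D// (addrC (- theta0)).
by rewrite -[leRHS]mulrA ler_wpM2l// [leRHS]mulrC ler_wpM2l ?powR_ge0.
Qed.

Lemma weighted_K_le_fine (A : set X1) u t : A 0 -> interp_space S i A theta p u ->
  0 < t -> t `^ (- theta) * K_functional S i A t u <=
    4 * fine (interp_norm S i A theta p u).
Proof.
move=> A0 Au t0; have := K_le_interp_norm S i theta01 p1 u A0 t0.
rewrite -{1}(@fineK _ (interp_norm _ _ _ _ _ _)); last first.
  by rewrite ge0_fin_numE// Lnorm_ge0.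
by rewrite lee_fin ler_pdivrMr// [X in _ <= X -> _]mulrC.
Qed.

Lemma fine_interp_norm_ge0 (A : set X1) u : 0 <= fine (interp_norm S i A theta p u).
Proof. by rewrite fine_ge0// Lnorm_ge0. Qed.

(** Between two scales s <= t one goes down from t by halving; the dyadic
    increments form a geometric series of ratio 2^-(theta - theta0), which is
    dominated by its first term. *)
Lemma trace_increment_le : exists2 C : R, 0 < C & forall u s t, X u ->
  0 < s -> s <= t -> t <= 1 ->
  rnorm S (PL t u - PL s u) <= C * fine (N u) * t `^ (theta - theta0).
Proof.
have [C C0 HC] := trace_difference_le Lambda_lin D_order.
pose q : R := 2^-1 `^ (theta - theta0).
have q1 : q < 1 by rewrite half_powR_lt1// subr_gt0.
exists (C * 4 / (1 - q)); first by rewrite divr_gt0 ?mulr_gt0//; lra.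
move=> u s t Xu s0 st t1.
set n := fine (N u); have n0 : 0 <= n by exact: fine_interp_norm_ge0.
have dyadic r r' : 0 < r' -> r' <= r -> r <= 1 -> r <= 2 * r' ->
    rnorm S (PL r u - PL r' u) <= C * 4 * n * r `^ (theta - theta0).
  move=> r'0 r'r r1 rr'; have r0 : 0 < r by lra.
  rewrite -(mulrA C); apply: (@le_of_weighted r _ C (KT r u)) => //.
  - exact: ltW.
  - by apply: HC => //; [apply/andP; split..|]; lra.
  - exact: weighted_K_le_fine.
(* the induction is on the number m of halvings that take t below s *)
have [m ms] := exists_half_exp_lt t s0.
set B := C * 4 / (1 - q).
(* B is the fixed point of the bound: one halving costs C * 4, and the bound
   for the remaining ones is multiplied by q *)
have BE : C * 4 + B * q = B by rewrite /B; field; lra.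
have B0 : 0 <= B by rewrite divr_ge0 ?mulr_ge0 ?(ltW C0)//; lra.
elim: m t st t1 ms => [|m IH] t st t1 ms.
  by move: ms; rewrite expr0 mul1r ltNge st.
have t0 : 0 < t by lra.
have [ts|ts] := leP t (2 * s).
  apply: (le_trans (dyadic t s s0 st t1 ts)).
  rewrite -!(mulrA _ n) ler_wpM2r ?mulr_ge0 ?powR_ge0//.
  rewrite -BE lerDl mulr_ge0// powR_ge0//.
apply: (le_trans (ler_rnorm_distD S (PL (2^-1 * t) u) _ _)).
have h1 : rnorm S (PL t u - PL (2^-1 * t) u) <= C * 4 * n * t `^ (theta - theta0).
  by apply: dyadic => //; lra.
have h2 : rnorm S (PL (2^-1 * t) u - PL s u) <=
    B * n * (2^-1 * t) `^ (theta - theta0).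
  by apply: IH; [lra|lra|rewrite mulrA -exprSr].
apply: (le_trans (lerD h1 h2)).
rewrite powRM ?(ltW t0)//.
rewrite -/q -{2}BE; rewrite le_eqVlt; apply/orP; left; apply/eqP; ring.
Qed.

Lemma proj_extension_cvg u : X u -> PL t u @[t --> 0^'+] --> proj_extension u.
Proof.
move=> Xu; apply: (@rnorm_cauchy_cvg _ _ S) => e e0.
have [C C0 HC] := trace_increment_le.
have n0 := fine_interp_norm_ge0 setT u.
have [||d /andP[d0 d1] dP] := @powR_near0 R (theta - theta0)
  (e / (C * fine (N u) + 1)).
- by rewrite subr_gt0.
- by rewrite divr_gt0// ltr_wpDl// mulr_ge0// ltW.
have B0 : 0 <= C * fine (N u) by rewrite mulr_ge0// ltW.
have le_e s t : 0 < s -> s <= t -> t < d -> rnorm S (PL t u - PL s u) < e.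
  move=> s0 st td; have t0 : 0 < t by lra.
  have t1 : t <= 1 by lra.
  apply: (le_lt_trans (HC u s t Xu s0 st t1)).
  have := dP t; rewrite t0 td => /(_ isT).
  rewrite ltr_pdivlMr; last lra.
  by have := powR_ge0 t (theta - theta0); nra.
exists d => // s t /andP[s0 sd] /andP[t0 td].
have [st|/ltW ts] := leP s t; last exact: le_e.
by rewrite rnormB; exact: le_e.
Qed.

(** Let s tend to 0 in [trace_increment_le]. *)
Lemma proj_extension_dist_le : exists2 C : R, 0 < C & forall u t, X u ->
  0 < t <= 1 ->
  rnorm S (PL t u - proj_extension u) <= C * fine (N u) * t `^ (theta - theta0).
Proof.
have [C C0 HC] := trace_increment_le; exists C => // u t Xu /andP[t0 t1].
apply/ler_addgt0Pr => e e0.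
have cP := (cvg_rnormP S _ (fun t => PL t u) _).1 (proj_extension_cvg Xu) _ e0.
have [s [[s0 st] Ps]] : exists s, (0 < s /\ s < t) /\
    rnorm S (PL s u - proj_extension u) < e.
  apply: (@filter_ex _ (0 : R)^'+); near=> s; split; last by near: s; exact: cP.
  by split; [near: s; exact: nbhs_right_gt|near: s; exact: nbhs_right_lt].
apply: le_trans (ler_rnorm_distD S (PL s u) _ _) _.
by apply: lerD; [apply: HC => //; exact: ltW|exact: ltW].
Unshelve. all: by end_near. Qed.

(** Pi u is compared with Lambda(1) u, whose norm in Y is bounded by
    K~(1,u), which is comparable to K(1,u). *)
Lemma proj_extension_le : exists2 C : R, 0 < C & forall u, X u ->
  rnorm S (proj_extension u) <= C * fine (N u).
Proof.
have [C C0 HC] := proj_extension_dist_le.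
have [C' C'0 HC'] := trace_le_KD Lambda_lin D_order.
have [C2 C20 HC2] := KD_le_KT_small S i_cont D.
have one : 0 < (1 : R) <= 1 by rewrite ltr01 lexx.
exists (C + C' * C2 * 4); first by rewrite addr_gt0 ?mulr_gt0.
move=> u Xu; have n0 := fine_interp_norm_ge0 setT u.
have := HC u 1 Xu one; rewrite powR1 mulr1 => h1.
have := HC' 1 u one; rewrite powR1 mul1r => h2.
have := HC2 1 u one; rewrite mul1r => h3.
have := weighted_K_le_fine (I : [set: X1] 0) Xu (ltr01 : 0 < (1 : R)).
rewrite powR1 mul1r => h4.
have := ler_rnorm_distD S (PL 1 u) (proj_extension u) 0.
rewrite !subr0 rnormB => h5.
have h6 := ler_wpM2l (ltW C'0) h3.
have h7 : C' * (C2 * KT 1 u) <= C' * (C2 * (4 * fine (N u))).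
  by rewrite !ler_wpM2l ?(ltW C'0) ?(ltW C20).
by move: h1 h2 h5 h6 h7; lra.
Qed.

Lemma proj_extension_linear : linear_on X proj_extension.
Proof.
move=> a u v Xu Xv; apply: cvg_lim => //.
rewrite (_ : (fun t => _) = (fun t => a *: PL t u + PL t v)); last first.
  by apply/funext => t; rewrite linearP quot_proj_linear.
by apply: cvgD; [apply: cvgZr|]; exact: proj_extension_cvg.
Qed.

Lemma proj_extensionB u v : X u -> X v ->
  proj_extension (u - v) = proj_extension u - proj_extension v.
Proof.
by move=> Xu Xv; rewrite addrC -scaleN1r proj_extension_linear// scaleN1r addrC.
Qed.

Lemma proj_extension_continuous : continuous_on S X N proj_extension.
Proof.
have [C C0 HC] := proj_extension_le.
move=> u Xu e e0; exists (e / C); first by rewrite divr_gt0.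
move=> v Xv uv; rewrite -proj_extensionB//.
have Xuv : X (u - v) by exact: lt_trans uv (ltry _).
apply: le_lt_trans (HC _ Xuv) _.
rewrite mulrC -ltr_pdivlMr// -lte_fin fineK//.
by rewrite ge0_fin_numE// Lnorm_ge0.
Qed.

(** On the smaller space K~(t,u) = O(t^theta), so |Lambda(t) u|_Y is
    O(t^(theta - theta0)). *)
Lemma trace_tends_to0 u : XT u -> PL t u @[t --> 0^'+] --> 0.
Proof.
move=> XTu; have [C C0 HC] := trace_le_KD Lambda_lin D_order.
have n0 := fine_interp_norm_ge0 [set` D] u.
apply/(cvg_rnormP S) => e e0.
set n := fine _ in n0.
have Cn : 0 <= C * (4 * n) by rewrite !mulr_ge0// ltW.
have [||d /andP[d0 d1] dP] := @powR_near0 R (theta - theta0)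
  (e / (C * (4 * n) + 1)).
- by rewrite subr_gt0.
- by rewrite divr_gt0// ltr_wpDl.
near=> t.
have t0 : 0 < t by near: t; exact: nbhs_right_gt.
have td : t < d by near: t; exact: nbhs_right_lt.
have t01 : 0 < t <= 1 by rewrite t0; lra.
rewrite subr0.
apply: (le_lt_trans (le_of_weighted t0 (ltW C0) (HC t u t01)
  (weighted_K_le_fine (rpred0 D) XTu t0))).
have := dP t; rewrite t0 td => /(_ isT).
rewrite ltr_pdivlMr; last lra.
by have := powR_ge0 t (theta - theta0); rewrite -/n; nra.
Unshelve. all: by end_near. Qed.

End extension_of_the_projection.
(** * The interpolation spaces of the subspace *)

Theorem theorem4p3 (R : realType) (K : numFieldType) (S : scalars R K)
  (X0 X1 : completeNormedModType K) (i : {linear X1 -> X0})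
  (i_inj : injective i) (i_cont : continuous i)
  (Lambda : R -> {linear X0 -> X1}) (Lambda_lin : linearisable S i Lambda)
  (theta0 : R) (theta0_01 : 0 < theta0 < 1)
  (D : submodClosed X1) (D_closed : closed [set` D])
  (Y : completeNormedModType K) (j : {linear quot_mod D -> Y})
  (D_order : interpolation_order S i Lambda j theta0)
  (theta : R) (theta_01 : 0 < theta < 1) (p : \bar R) (p_ge1 : (1 <= p)%E) :
  let XT := interp_space S i [set` D] theta p in
  let NT := interp_norm S i [set` D] theta p in
  let X := interp_space S i setT theta p in
  let N := interp_norm S i setT theta p in
  let M := fun u => (N u + trace_norm S Lambda j theta0 theta p u)%E in
  [/\ XT = [set u | X u /\ (M u < +oo)%E],
      equivalent_norms XT NT M,
      theta < theta0 ->
        [/\ XT = X, closed_subspace X N XT & equivalent_norms XT NT N] &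
      theta0 < theta ->
        exists Pi : X0 -> Y,
          [/\ linear_on X Pi, continuous_on S X N Pi,
              (* Pi extends the projection X1 -> X1 / D -> Y.  Any continuous
                 extension forces the premise below, because Lambda(t) w tends
                 to w in X for w in X1; the other hypotheses do not imply it. *)
              forall w : X1,
                quot_proj j (Lambda t (i w)) @[t --> 0^'+] --> quot_proj j w ->
                Pi (i w) = quot_proj j w &
              [/\ XT = X `&` [set u | Pi u = 0], closed_subspace X N XT &
                  equivalent_norms XT NT N]]].
Proof.
move=> XT NT X N M.
have D0 : [set` D] 0 by exact: (rpred0 D).
have NT_N u : (N u <= NT u)%E by exact: interp_norm_setT_le.
have XT_X : XT `<=` X by move=> u; exact: le_lt_trans (NT_N u).
have [C C0 HC] :=
  interp_norm_le_trace_norm i_cont Lambda_lin D_order theta p_ge1.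
have [C' C'0 HC'] := trace_norm_le_interp_norm Lambda_lin D_order theta p_ge1.
have C1 : 0 < 1 + C' by rewrite addr_gt0.
have M_NT u : (M u <= (1 + C')%:E * NT u)%E.
  by rewrite EFinD ge0_muleDl ?lee_fin ?(ltW C'0)// mul1e leeD.
have NT_M u : ((C^-1)%:E * NT u <= M u)%E.
  by rewrite lee_pdivrMl; [exact: HC|].
have XT_M : XT = [set u | X u /\ (M u < +oo)%E].
  apply/seteqP; split=> u /=.
    move=> XTu; split; first exact: XT_X.
    by apply: le_lt_trans (M_NT u) _; rewrite lte_mul_pinfty// lee_fin ltW.
  move=> [_ Mu]; apply: (le_lt_trans (HC u)).
  by rewrite lte_mul_pinfty// lee_fin ltW.
have NT_equiv B : 0 < B -> (forall u, XT u ->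
    (trace_norm S Lambda j theta0 theta p u <= B%:E * N u)%E) ->
    equivalent_norms XT NT N.
  move=> B0 HB; have CB : 0 < C * (1 + B) by rewrite mulr_gt0 ?addr_gt0.
  exists (C * (1 + B))^-1, 1; split; rewrite ?invr_gt0// => u XTu.
  rewrite mul1e NT_N andbT lee_pdivrMl//; apply: (le_trans (HC u)).
  rewrite EFinM -muleA; apply: lee_wpmul2l; first by rewrite lee_fin ltW.
  rewrite EFinD ge0_muleDl ?lee_fin ?(ltW B0)// mul1e leeD2l//.
  exact: HB.
have XZD (a : K) u v : X u -> X v -> X (a *: u + v).
  by apply: interp_space_linear.
split=> //.
- exists C^-1, (1 + C'); split=> //; first by rewrite invr_gt0.
  by move=> u _; rewrite NT_M M_NT.
- move=> th.
  have [B B0 HB] := trace_norm_le_below i_cont Lambda_lin D_order p_ge1 th.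
  have XE : XT = X.
    apply/seteqP; split=> // u Xu; rewrite XT_M; split=> //.
    rewrite lte_add_pinfty//; apply: (le_lt_trans (HB u)).
    by rewrite lte_mul_pinfty ?lee_fin ?(ltW B0)// Lnorm_ge0.
  split=> //; last by apply: (NT_equiv B) => // u _; exact: HB.
  split; rewrite XE//; first exact: interp_space0.
- move=> th.
  have [B B0 HB] := trace_norm_le_above Lambda_lin D_order p_ge1 th.
  have Pcvg u : X u -> _ :=
    proj_extension_cvg Lambda_lin D_order theta_01 p_ge1 th (u := u).
  have [E E0 HE] :=
    proj_extension_le i_cont Lambda_lin D_order theta_01 p_ge1 th.
  have Pt0 u : XT u -> _ :=
    trace_tends_to0 Lambda_lin D_order theta_01 p_ge1 th (u := u).
  have Plin := proj_extension_linear Lambda_lin D_order theta_01 p_ge1 th.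
  have PB := proj_extensionB Lambda_lin D_order theta_01 p_ge1 th.
  exists (proj_extension Lambda j).
  have XE : XT = X `&` [set u | proj_extension Lambda j u = 0].
    apply/seteqP; split=> u /=.
      by move=> XTu; split; [exact: XT_X|exact/cvg_lim/Pt0].
    move=> [Xu Pu]; rewrite XT_M; split=> //.
    rewrite lte_add_pinfty//; apply: (le_lt_trans (HB u _)).
      by rewrite -Pu; exact: Pcvg.
    by rewrite lte_mul_pinfty ?lee_fin ?(ltW B0)// Lnorm_ge0.
  split=> //.
  + exact: (proj_extension_continuous i_cont Lambda_lin
      D_order theta_01 p_ge1 th).
  + by move=> w Pw; exact: cvg_lim.
  split=> //; last by apply: (NT_equiv B) => // u XTu; exact/HB/Pt0.
  split=> //.
  + exact: interp_space0.
  + move=> a u v; rewrite XE => -[Xu Pu] [Xv Pv]; split; first exact: XZD.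
    by rewrite /= Plin// Pu Pv scaler0 addr0.
  move=> u Xu uA; rewrite XE; split=> //=; apply: (@rnorm_eq0 _ _ S).
  apply/eqP; rewrite eq_le rnorm_ge0 andbT; apply/ler_addgt0Pr => e e0.
  rewrite add0r.
  have [|v XTv uv] := uA (e / E); first by rewrite divr_gt0.
  have [Xv Pv] : (X `&` [set u | proj_extension Lambda j u = 0]) v by rewrite -XE.
  have Xuv : X (u - v) by exact: lt_trans uv (ltry _).
  rewrite -[proj_extension _ _ u]subr0 -Pv -PB//.
  apply: le_trans (HE _ Xuv) _.
  rewrite mulrC -ler_pdivlMr// -lee_fin fineK; first exact: ltW.
  by rewrite ge0_fin_numE// Lnorm_ge0.
Qed.
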